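(* Let $G=(V,E)$ be a locally finite graph and let $\Omega\cup\partial\Omega\subset V$ be a bounded domain with $\Omega\neq\emptyset$ and $\partial\Omega\neq\emptyset$. Let $m_1,m_2$ be positive integers, $p,q,\gamma_1,\gamma_2>1$, $\alpha,\beta>0$ with $\max\{\gamma_1,\gamma_2\}<\min\{p,q\}\le\max\{p,q\}<\alpha+\beta$, and let $h_1,h_2,c:\Omega\to\mathbb{R}^+=(0,+\infty)$. Put $C_0=\max_{x\in\Omega}c(x)$, $$M_{(\lambda_1,\lambda_2)}=2^{1-\max\{p,q\}}\min\left\{\frac{1-\lambda_1C_{m_1,p}^p(\Omega)}{p},\frac{1-\lambda_2C_{m_2,q}^q(\Omega)}{q}\right\},\qquad M_2=\frac{C_0}{(\alpha+\beta)^2}\left(\alpha C_{m_1,p}^{\alpha+\beta}(\Omega)+\beta C_{m_2,q}^{\alpha+\beta}(\Omega)\right).$$ Suppose $(\lambda_1,\lambda_2)\in(0,+\infty)\times(0,+\infty)$ satisfies all of the following: (1) $0<\lambda_1<C_{m_1,p}^{-p}(\Omega)$; (2) $0<\lambda_2<C_{m_2,q}^{-q}(\Omega)$; (3) $M_{(\lambda_1,\lambda_2)}\le\frac{\alpha+\beta}{\max\{p,q\}}M_2$; (4) $$\frac{\lambda_1(p-\gamma_1)}{p\gamma_1}\|h_1\|_{L^{\frac{p}{p-\gamma_1}}(\Omega)}^{\frac{p}{p-\gamma_1}}+\frac{\lambda_2(q-\gamma_2)}{q\gamma_2}\|h_2\|_{L^{\frac{q}{q-\gamma_2}}(\Omega)}^{\frac{q}{q-\gamma_2}}<\frac{\alpha+\beta-\max\{p,q\}}{\alpha+\beta}M_{(\lambda_1,\lambda_2)}^{\frac{\alpha+\beta}{\alpha+\beta-\max\{p,q\}}}\left(\frac{\max\{p,q\}}{(\alpha+\beta)M_2}\right)^{\frac{\max\{p,q\}}{\alpha+\beta-\max\{p,q\}}}.$$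 Then the system $$\begin{cases}\pounds_{m_1,p}u=\lambda_1h_1(x)|u|^{\gamma_1-2}u+\frac{\alpha}{\alpha+\beta}c(x)|u|^{\alpha-2}u|v|^{\beta},&x\in\Omega,\\ \pounds_{m_2,q}v=\lambda_2h_2(x)|v|^{\gamma_2-2}v+\frac{\beta}{\alpha+\beta}c(x)|u|^{\alpha}|v|^{\beta-2}v,&x\in\Omega,\\ u=v=0,&x\in\partial\Omega,\end{cases}$$ has at least one nontrivial solution of positive energy and at least one nontrivial solution of negative energy; that is, there are solutions $(u^\star,v^\star)\ne(0,0)$ with $\varphi(u^\star,v^\star)>0$ and $(u^{\star\star},v^{\star\star})\neq(0,0)$ with $\varphi(u^{\star\star},v^{\star\star})<0$, where $\varphi$ is the energy functional given in the context.
   Context: Graph setting. $G=(V,E)$ is a graph with vertex set $V$ and edge set $E$; it is locally finite if every vertex lies on only finitely many edges. $y\sim x$ means $xy\in E$. Each edge has a weight $\omega_{xy}=\omega_{yx}>0$. $\mu:V\to(0,+\infty)$ is a (finite-valued) measure with $\mu(x)\ge\mu_0>0$ for all $x$. $\int_A f\,d\mu=\sum_{x\in A}f(x)\mu(x)$. $d(x,y)$ is the minimal number of edges connecting $x$ and $y$; a set of vertices is a bounded domain if $d(x,y)$ is uniformly bounded for $x,y$ in it. $\partial\Omega=\{y\in V\setminus\Omega:\exists x\in\Omega,\ xy\in E\}$. Operators, for $u,u_1,u_2:V\to\mathbb{R}$: $\Delta u(x)=\frac1{\mu(x)}\sum_{y\sim x}\omega_{xy}(u(y)-u(x))$; $\Gamma(u_1,u_2)(x)=\frac{1}{2\mu(x)}\sum_{y\sim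 x}\omega_{xy}(u_1(y)-u_1(x))(u_2(y)-u_2(x))$; $|\nabla u|=\sqrt{\Gamma(u,u)}$; $|\nabla^mu|=|\nabla\Delta^{\frac{m-1}2}u|$ if $m$ is odd and $|\nabla^mu|=|\Delta^{\frac m2}u|$ if $m$ is even. Spaces. $C_c(\Omega)=\{u:V\to\mathbb{R}: u=0 \text{ on } V\setminus\Omega\}$. $\|u\|_{L^r(\Omega)}=(\int_\Omega|u|^rd\mu)^{1/r}$ for $1\le r<\infty$, $\|u\|_\infty=\max_\Omega|u|$. $W_0^{m,s}(\Omega)$ ($m\ge1$ integer, $s>1$) is the completion of $C_c(\Omega)$ under $\|u\|_{W_0^{m,s}(\Omega)}=(\int_{\Omega\cup\partial\Omega}|\nabla^mu|^sd\mu)^{1/s}$; it is finite-dimensional. $W=W_0^{m_1,p}(\Omega)\times W_0^{m_2,q}(\Omega)$ with $\|(u,v)\|_W=\|u\|_{W_0^{m_1,p}(\Omega)}+\|v\|_{W_0^{m_2,q}(\Omega)}$. Embedding constants. $C_{m,s}(\Omega)>0$ is a fixed constant depending only on $m,s,\Omega$ such that $\|u\|_{L^r(\Omega)}\le C_{m,s}(\Omega)\|u\|_{W_0^{m,s}(\Omega)}$ for all $u\in W_0^{m,s}(\Omega)$ and all $1\le r\le+\infty$ (such constants exist). The operator $\pounds_{m,s}$ is defined by: for every $\phi\in C_c(\Omega)$, $\int_\Omega(\pounds_{m,s}u)\phi\,d\mu$ equals $\int_{\Omega\cup\partial\Omega}|\nabla^mu|^{s-2}\Gamma(\Delta^{\frac{m-1}2}u,\Delta^{\frac{m-1}2}\phi)\,d\mu$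 if $m$ is odd and $\int_{\Omega\cup\partial\Omega}|\nabla^mu|^{s-2}\Delta^{\frac m2}u\,\Delta^{\frac m2}\phi\,d\mu$ if $m$ is even. Convention: $|t|^{a-2}t$ is taken to be $0$ at $t=0$, and likewise the integrands defining $\pounds_{m,s}$ are $0$ where $|\nabla^m u|=0$. A solution is a pair $(u,v)\in W$ satisfying the system at every point; it is nontrivial if $(u,v)\ne(0,0)$. Its energy is $\varphi(u,v)$, where $\varphi:W\to\mathbb{R}$, $$\varphi(u,v)=\frac1p\int_{\Omega\cup\partial\Omega}|\nabla^{m_1}u|^pd\mu-\frac{\lambda_1}{\gamma_1}\int_\Omega h_1|u|^{\gamma_1}d\mu+\frac1q\int_{\Omega\cup\partial\Omega}|\nabla^{m_2}v|^qd\mu-\frac{\lambda_2}{\gamma_2}\int_\Omega h_2|v|^{\gamma_2}d\mu-\frac1{\alpha+\beta}\int_\Omega c|u|^\alpha|v|^\beta d\mu.$$ *)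

(* Defs.v *)
From HB Require Import structures.
From mathcomp Require Import all_boot all_order all_algebra.
From mathcomp Require Import all_classical all_reals all_analysis.
Set Implicit Arguments.
Unset Strict Implicit.
Unset Printing Implicit Defensive.
Import Order.TTheory GRing.Theory Num.Theory.
Import numFieldNormedType.Exports.
Local Open Scope classical_set_scope.
Local Open Scope ring_scope.

(* [weight] is only meaningful on edges. Loops are not excluded: they do not
   change distances, boundaries, the Laplacian or the gradient form. *)
Record wgraph (R : realType) (V : choiceType) := WGraph {
  adj : rel V;
  weight : V -> V -> R;
  mu : V -> R;
  adj_sym : symmetric adj;
  weight_sym : forall x y, adj x y -> weight x y = weight y x;
  weight_gt0 : forall x y, adj x y -> 0 < weight x y;
  mu_bounded_below : exists2 mu0 : R, 0 < mu0 & forall x, mu0 <= mu x }.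

Section Graph.
Context {R : realType} {V : choiceType}.
Variable G : wgraph R V.
Implicit Types (A Omega : set V) (u v phi : V -> R) (x y : V).

Definition nbr x : set V := [set y | adj G x y].

Definition locally_finite := forall x, finite_set (nbr x).

(* [+oo] when no path joins [x] and [y]. *)
Definition gdist x y : \bar R :=
  ereal_inf [set ((size t)%:R)%:E |
             t in [set t : seq V | path (adj G) x t /\ last x t = y]].

Definition bounded_domain A :=
  exists D : R, forall x y, A x -> A y -> (gdist x y <= D%:E)%E.

Definition bdry Omega : set V :=
  [set y | ~ Omega y /\ exists2 x, Omega x & adj G x y].

Definition clos Omega : set V := Omega `|` bdry Omega.

(* The sum over a set is the finitely supported sum of [fsbigop]; it is only
   used on the finite sets [nbr x], [Omega] and [clos Omega] (a bounded domain
   of a locally finite graph is finite). *)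
Definition integral_on A u : R := \sum_(x \in A) (u x * mu G x).

Definition lap u : V -> R := fun x =>
  (mu G x)^-1 * \sum_(y \in nbr x) (weight G x y * (u y - u x)).

Definition Gam u v : V -> R := fun x =>
  (2 * mu G x)^-1 *
  \sum_(y \in nbr x) (weight G x y * (u y - u x) * (v y - v x)).

Definition gradn u : V -> R := fun x => Num.sqrt (Gam u u x).

(* [m./2] is (m-1)/2 for [m] odd. *)
Definition gradm (m : nat) u : V -> R := fun x =>
  if odd m then gradn (iter m./2 lap u) x else `|iter m./2 lap u x|.

Definition Cc Omega : set (V -> R) := [set u | forall x, ~ Omega x -> u x = 0].

(* On a nonempty finite [Omega] the supremum is the maximum. *)
Definition normL Omega (r : \bar R) u : R :=
  match r with
  | r'%:E => integral_on Omega (fun x => `|u x| `^ r') `^ r'^-1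
  | +oo%E => sup [set `|u x| | x in Omega]
  | -oo%E => 0
  end.

Definition W0norm Omega (m : nat) (s : R) u : R :=
  integral_on (clos Omega) (fun x => gradm m u x `^ s) `^ s^-1.

(* The completion of [Cc Omega] for [W0norm], realized as a space of functions
   on [V]: the pointwise limits of the [W0norm]-Cauchy sequences of
   [Cc Omega] (on which [W0norm] controls the maximum norm). *)
Definition W0 Omega (m : nat) (s : R) : set (V -> R) := [set u |
  exists un : nat -> V -> R,
  [/\ forall n, Cc Omega (un n),
      forall eps : R, 0 < eps -> exists N : nat, forall i j : nat,
        (N <= i)%N -> (N <= j)%N ->
        W0norm Omega m s (fun x => un i x - un j x) < eps
    & forall x, un n x @[n --> \oo] --> u x]].

Definition embedding_constant Omega (m : nat) (s C : R) :=
  0 < C /\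
  forall u, W0 Omega m s u -> forall r : \bar R, (1 <= r)%E ->
    normL Omega r u <= C * W0norm Omega m s u.

(* Since [0 `^ a] is [0] for [a != 0] and [1] for [a = 0], the integrands below
   vanish wherever [gradm m u] does: at such a point [Gam (iter m./2 lap u) _],
   resp. [iter m./2 lap u], is zero. *)
Definition pounds_form Omega (m : nat) (s : R) u phi : R :=
  integral_on (clos Omega) (fun x => gradm m u x `^ (s - 2) *
    (if odd m then Gam (iter m./2 lap u) (iter m./2 lap phi) x
     else iter m./2 lap u x * iter m./2 lap phi x)).

(* [L] is the function £_{m,s} u; this determines [L] uniquely on [Omega]. *)
Definition is_pounds Omega (m : nat) (s : R) u (L : V -> R) :=
  forall phi, Cc Omega phi ->
    integral_on Omega (fun x => L x * phi x) = pounds_form Omega m s u phi.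

Definition solution Omega (m1 m2 : nat) (p q g1 g2 al be l1 l2 : R)
    (h1 h2 c : V -> R) u v :=
  [/\ W0 Omega m1 p u, W0 Omega m2 q v,
      exists2 L, is_pounds Omega m1 p u L & forall x, Omega x ->
        L x = l1 * h1 x * (`|u x| `^ (g1 - 2) * u x) +
              al / (al + be) * c x * (`|u x| `^ (al - 2) * u x) * `|v x| `^ be,
      exists2 L, is_pounds Omega m2 q v L & forall x, Omega x ->
        L x = l2 * h2 x * (`|v x| `^ (g2 - 2) * v x) +
              be / (al + be) * c x * `|u x| `^ al * (`|v x| `^ (be - 2) * v x)
    & forall x, bdry Omega x -> u x = 0 /\ v x = 0].

Definition energy Omega (m1 m2 : nat) (p q g1 g2 al be l1 l2 : R)
    (h1 h2 c : V -> R) u v : R :=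
  p^-1 * integral_on (clos Omega) (fun x => gradm m1 u x `^ p)
  - l1 / g1 * integral_on Omega (fun x => h1 x * `|u x| `^ g1)
  + q^-1 * integral_on (clos Omega) (fun x => gradm m2 v x `^ q)
  - l2 / g2 * integral_on Omega (fun x => h2 x * `|v x| `^ g2)
  - (al + be)^-1 *
    integral_on Omega (fun x => c x * `|u x| `^ al * `|v x| `^ be).

Lemma lap_cst0 : lap (fun=> 0) = fun=> 0.
Proof.
by apply/funext => x; rewrite /lap fsbig1 ?mulr0// => y _; rewrite subrr mulr0.
Qed.

Lemma iter_lap_cst0 n : iter n lap (fun=> 0) = fun=> 0.
Proof. by elim: n => //= n ->; rewrite lap_cst0. Qed.

Lemma gradm_cst0 m : gradm m (fun=> 0) = fun=> 0.
Proof.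
apply/funext => x; rewrite /gradm iter_lap_cst0 normr0 /gradn /Gam.
rewrite fsbig1 ?mulr0 ?sqrtr0 ?if_same// => y _.
by rewrite subrr !mulr0.
Qed.

Lemma W0norm_cst0 Omega m s : s != 0 -> W0norm Omega m s (fun=> 0) = 0.
Proof.
move=> s0; rewrite /W0norm /integral_on gradm_cst0 fsbig1.
  by rewrite powR0 ?invr_eq0.
by move=> x _; rewrite powR0 ?mul0r.
Qed.

(* [Cc Omega] is finite dimensional, so the completion adds nothing. *)
Lemma W0E Omega m s : s != 0 -> W0 Omega m s = Cc Omega.
Proof.
move=> s0; apply/seteqP; split => u.
- move=> [un [unC _ unu]] x Ox.
  have : un n x @[n --> \oo] --> (0 : R).
    rewrite (_ : (fun n => un n x) = fun=> 0); first exact: cvg_cst.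
    by apply/funext => n; rewrite unC.
  by move=> un0; exact: (cvg_unique _ (unu x) un0).
- move=> uC; exists (fun=> u); split => //.
    move=> e e0; exists 0%N => i j _ _.
    rewrite (_ : (fun x => _) = fun=> 0) ?W0norm_cst0//.
    by apply/funext => x; rewrite subrr.
  by move=> x; exact: cvg_cst.
Qed.

End Graph.

(* Main.v *)
Require Import Defs.
From HB Require Import structures.
From mathcomp Require Import all_boot all_order all_algebra.
From mathcomp Require Import all_classical all_reals all_analysis.
From mathcomp Require Import finmap ring lra.
Set Implicit Arguments.
Unset Strict Implicit.
Unset Printing Implicit Defensive.
Import Order.TTheory GRing.Theory Num.Theory.
Import numFieldNormedType.Exports.
Local Open Scope classical_set_scope.
Local Open Scope ring_scope.

(* Along a ray, the energy of [(t u, t v)] is a generalized polynomial in [t]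
   whose coefficients have signs -, +, - in the order of the exponents
   (concave terms, operators, coupling). It therefore has at most two critical
   points, and one of positive height is the unique maximum on its ray.
   Conditions (3) and (4) make the energy at least some [rho > 0] on a sphere
   that all rays meet, so the set of critical points of positive height (the
   upper part of the Nehari manifold) is closed; it is nonempty and the energy
   is coercive on it, so in this finite dimensional space there is a minimizer.
   Moving one coordinate of the minimizer, and following the maximum on the
   ray, gives one-sided derivatives of the energy that are nonnegative in both
   directions. Where the coupling term is differentiable this is the
   equation at that vertex; where it is not (an exponent at most 1 at a zero of
   that component), its downward cusp contradicts minimality, so the argument
   covers all exponents [al, be > 0]. The solution of negative energy is
   [(u, 0)], with [u] a global minimizer of the energy of the first equation
   alone. *)

(** * Powers of the absolute value *)

Section AbsolutePower.
Context {R : realType}.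
Implicit Types a b t : R.

(** When [al] or [be] is at most 1 the energy need not be differentiable, so neither a critical
    point theorem for smooth functionals nor a multiplier rule on the Nehari set is at hand. Their
    substitute is a comparison of critical values on neighbouring rays: after a small change of the
    coefficients the ray keeps a critical point near [t = 1], and since [t = 1] maximizes the
    unchanged ray, the displacement of that point can only lower the value. An upper bound on the
    one-sided growth of each coefficient is then enough. The constants come from the sphere. Young's
    inequality and the embedding cost the fraction [l1 * C1 ^ p] (resp. [l2 * C2 ^ q]) of each
    operator term, plus the sum on the left of condition (4); the coupling costs at most
    [M2 * r ^ (al + be)]. For norms at most 1 both operator powers dominate the power [max p q], and
    convexity combines them at the price [2 ^ (1 - max p q)]. Condition (3) says that the best
    radius is at most 1, and condition (4) that the bound there exceeds the additive loss. *)

Lemma continuous_norm_powR a : 0 < a -> continuous (fun t : R => `|t| `^ a).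
Proof.
move=> a0 t; have [->|t0] := eqVneq t 0.
  rewrite /continuous_at normr0 powR0 ?gt_eqF//; apply/cvgr0Pnorm_lt => e e0.
  near=> h; rewrite ger0_norm ?powR_ge0//.
  rewrite -[ltRHS](@powRr1 _ e) ?ltW// -(mulVf (lt0r_neq0 a0)) powRrM.
  rewrite gt0_ltr_powR// ?nnegrE ?powR_ge0//.
  near: h; apply: (@cvgr0_norm_lt _ _ _ (nbhs (0:R)) _ id) => //.
  by rewrite powR_gt0.
apply: (@continuous_comp _ _ _ (fun x : R => `|x|) (@powR R ^~ a)).
  exact: norm_continuous.
apply: differentiable_continuous; apply/derivable1_diffP/derivable_powR.
by rewrite in_itv/= andbT normr_gt0.
Unshelve. all: by end_near. Qed.

Lemma norm_powR_split a t : 1 < a -> `|t| `^ a = `|t| * `|t| `^ (a - 1).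
Proof. by move=> a1; rewrite mulr_powRB1// (lt_trans ltr01). Qed.

(** At [t = 0] the formula gives 0 because of the factor [t], and the difference quotient has
    absolute value [|h| ^ (a - 1)], which tends to 0 only for [a > 1]. *)
Lemma is_derive_norm_powR a t : (1 < a) || (t != 0) ->
  is_derive t 1 (fun x : R => `|x| `^ a) (a * (`|t| `^ (a - 2) * t)).
Proof.
move=> a1; have pE x : 0 < x -> a * x `^ (a - 1) = a * (x `^ (a - 2) * x) :> R.
  move=> x0; congr (_ * _); rewrite -[X in _ = _ * X](@powRr1 _ x) ?ltW//.
  rewrite -powRD; last by rewrite (gt_eqF x0) implybT.
  by rewrite (_ : a - 2 + 1 = a - 1)//; ring.
have [t0|t0|t0] := ltgtP t 0.
- have : is_derive t 1 (@powR R ^~ a \o -%R) (a * `|t| `^ (a - 1) * -1).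
    by apply: is_derive1_comp; rewrite ltr0_norm//; apply: is_derive1_powR;
      rewrite oppr_gt0.
  rewrite pE ?normr_gt0 ?lt_eqF// (_ : _ * -1 = a * (`|t| `^ (a - 2) * t)).
    apply: near_eq_is_derive; near=> x => /=; rewrite ltr0_norm//.
    by near: x; exact: lt_nbhsl.
  by rewrite ltr0_norm//; ring.
- have := is_derive1_powR a t0; rewrite pE// gtr0_norm//.
  apply: near_eq_is_derive; near=> x; rewrite gtr0_norm//.
  by near: x; exact: lt_nbhsr.
- move: a1; rewrite t0 eqxx orbF => a1.
  have a0 : 0 < a by rewrite (lt_trans ltr01).
  have d0 : (fun h : R => h^-1 *: ((fun x : R => `|x| `^ a) (h *: 1 + 0) -
      `|0 : R| `^ a)) @ 0^' --> (0 : R).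
    apply/cvgr0Pnorm_lt => e e0; near=> h.
    have h0 : h != 0 by near: h; exact: nbhs_dnbhs_neq.
    rewrite normr0 powR0 ?gt_eqF// subr0 addr0 /GRing.scale/= mulr1.
    rewrite norm_powR_split// normrM normfV normrM normr_id mulKf ?normr_eq0//.
    near: h; apply: cvg_within; have a10 : 0 < a - 1 by rewrite subr_gt0.
    have := continuous_norm_powR a10 (x := 0).
    rewrite /continuous_at normr0 powR0 ?gt_eqF// => /cvgr0Pnorm_lt; exact.
  rewrite !mulr0; split; first by apply/cvg_ex; exists 0.
  exact: cvg_lim d0.
Unshelve. all: by end_near. Qed.

Lemma right_derivative (f : R -> R) d : is_derive (0 : R) 1 f d ->
  (f h - f 0) / h @[h --> 0^'+] --> d.
Proof.
move=> [df <-]; apply: cvg_dnbhs_at_right.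
rewrite (_ : (fun h => _) = (fun h : R => h^-1 *: (f (h *: 1 + 0) - f 0))) //.
by apply/funext => h; rewrite addr0 /GRing.scale/= mulr1 mulrC.
Qed.

(** The two powers cross at [t0 = (k2 / k1) ^ (1 / (b - a))]: beyond it the higher one dominates,
    before it the value at [t0] serves as [B]. *)
Lemma powR_abs_bound a b (k1 k2 : R) : 0 < a -> a < b -> 0 < k1 -> 0 <= k2 ->
  exists2 B, 0 <= B & forall t, 0 <= t -> k2 * t `^ a <= k1 * t `^ b + B.
Proof.
move=> a0 ab k10 k20; pose t0 := (k2 / k1) `^ (b - a)^-1.
exists (k2 * t0 `^ a) => [|t tge0]; first by rewrite mulr_ge0 ?powR_ge0.
have [tt0|tt0] := leP t t0.
  apply: ler_wpDl; first by rewrite mulr_ge0 ?powR_ge0 ?ltW.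
  by rewrite ler_wpM2l// ge0_ler_powR// ?ltW// nnegrE ?powR_ge0.
apply: ler_wpDr; first by rewrite mulr_ge0 ?powR_ge0.
have t_gt0 : 0 < t by rewrite (le_lt_trans _ tt0) ?powR_ge0.
have ba : 0 < b - a by rewrite subr_gt0.
have : t0 `^ (b - a) <= t `^ (b - a).
  by rewrite ge0_ler_powR ?nnegrE ?powR_ge0// ?ltW.
rewrite /t0 -powRrM mulVf ?gt_eqF// powRr1; last by rewrite divr_ge0// ltW.
rewrite ler_pdivrMr// => H.
have -> : t `^ b = t `^ (b - a) * t `^ a.
  by rewrite -powRD ?subrK// (gt_eqF t_gt0) implybT.
by rewrite mulrA ler_wpM2r ?powR_ge0// mulrC.
Qed.

End AbsolutePower.

(** * Generalized polynomials *)

Section GeneralizedPolynomials.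
Context {R : realType}.
Implicit Types (l : seq (R * R)) (t x y z : R).

(* [c = (c.1, c.2)] stands for the term with coefficient [c.1] and real
   exponent [c.2]. *)
Definition gpoly l t : R := \sum_(c <- l) c.1 * `|t| `^ c.2.

(** The primitive with respect to [dt / t]: [gpoly l t] is [t] times the derivative of
    [gpoly (gprim l)] at [t], so exponents are kept and critical points are the zeros of
    [gpoly l]. *)
Definition gprim l : seq (R * R) := [seq (c.1 / c.2, c.2) | c <- l].

Lemma is_derive_gpoly l t : 0 < t ->
  is_derive t 1 (gpoly l) (gpoly [seq (c.1 * c.2, c.2 - 1) | c <- l] t).
Proof.
move=> t0; rewrite /gpoly; elim: l => [|c l IHl].
  rewrite big_nil (_ : (fun t => _) = cst 0); first exact: is_derive_cst.
  by apply/funext => x; rewrite big_nil.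
rewrite [X in is_derive _ _ X](_ : _ = (fun x => c.1 * `|x| `^ c.2) +
    (fun x => \sum_(c <- l) c.1 * `|x| `^ c.2)); last first.
  by apply/funext => x; rewrite big_cons.
rewrite /= big_cons/=; apply: is_deriveD.
rewrite -mulrA gtr0_norm//.
apply: (@near_eq_is_derive _ _ _ (c.1 \*: (@powR R ^~ c.2))) => [|].
  by near=> x; rewrite gtr0_norm//; near: x; exact: lt_nbhsr.
exact: (is_deriveZ c.1 (is_derive1_powR c.2 t0)).
Unshelve. all: by end_near. Qed.

Lemma gpoly_shift k l t : 0 < t ->
  gpoly l t = t `^ k * gpoly [seq (c.1, c.2 - k) | c <- l] t.
Proof.
move=> t0; rewrite /gpoly big_map mulr_sumr; apply: eq_bigr => c _ /=.
rewrite mulrCA gtr0_norm// -powRD ?subrKC//.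
by rewrite (gt_eqF t0) implybT.
Qed.

Lemma gpoly_nincr l x y : (forall c, c \in l -> c.1 * c.2 <= 0) ->
  0 < x -> x <= y -> gpoly l y <= gpoly l x.
Proof.
move=> lP x0 xy; have y0 : 0 < y by exact: lt_le_trans xy.
rewrite /gpoly big_seq [leRHS]big_seq; apply: ler_sum => c /lP.
rewrite !gtr0_norm//; have [c20|c20|->] := ltgtP c.2 0.
- rewrite nmulr_lle0// => c10; apply: ler_wpM2l => //.
  rewrite -[c.2]opprK powRN [leRHS]powRN lef_pV2 ?posrE ?powR_gt0//.
  by rewrite ge0_ler_powR// ?nnegrE ?oppr_ge0 ltW.
- rewrite pmulr_lle0// => c10; apply: ler_wnM2l => //.
  by rewrite ge0_ler_powR// ?nnegrE ltW.
- by rewrite !powRr0.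
Qed.

Lemma gpoly_derivative_mvt l x y : 0 < x -> x < y ->
  exists2 z, x < z < y & gpoly l y - gpoly l x =
    gpoly [seq (c.1 * c.2, c.2 - 1) | c <- l] z * (y - x).
Proof.
move=> x0 xy; have [||z] := @MVT _ (gpoly l)
    (gpoly [seq (c.1 * c.2, c.2 - 1) | c <- l]) _ _ xy.
- move=> z; rewrite in_itv/= => /andP[xz _].
  by apply: is_derive_gpoly; exact: lt_trans xz.
- apply: derivable_within_continuous => z; rewrite in_itv/= => /andP[xz _].
  by apply: ex_derive; apply: is_derive_gpoly; exact: lt_le_trans xz.
- by rewrite in_itv/= => zxy ->; exists z.
Qed.

(* The hypothesis describes the sign pattern -, +, -: after division by
   [t `^ P] and one differentiation, the quotient by [t `^ (m - P - 1)] is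
   nonincreasing, so the sign changes at most twice. *)
Lemma gpoly_two_sign_changes (m P : R) l x y z :
  (forall c, c \in l -> c.1 * (c.2 - P) * (c.2 - m) <= 0) ->
  0 < x -> x < y -> y < z -> 0 < gpoly l x -> gpoly l y <= 0 -> gpoly l z < 0.
Proof.
move=> lP x0 xy yz; have y0 := lt_trans x0 xy; have z0 := lt_trans y0 yz.
rewrite (gpoly_shift P l x0) (gpoly_shift P l y0) (gpoly_shift P l z0).
rewrite pmulr_rgt0 ?powR_gt0// pmulr_rle0 ?powR_gt0//.
rewrite pmulr_rlt0 ?powR_gt0//; set l' := map _ l => x_gt0 y_le0.
have [u /andP[xu uy] eu] := gpoly_derivative_mvt l' x0 xy.
have [v /andP[yv vz] ev] := gpoly_derivative_mvt l' y0 yz.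
have u0 := lt_trans x0 xu; have uv := lt_trans uy yv; have v0 := lt_trans u0 uv.
have : gpoly [seq (c.1 * c.2, c.2 - 1) | c <- l'] u < 0.
  by rewrite -(@pmulr_llt0 _ (y - x)) ?subr_gt0// -eu subr_lt0 (le_lt_trans
      y_le0).
rewrite (gpoly_shift (m - P - 1) _ u0) pmulr_rlt0 ?powR_gt0// => Hu.
rewrite (lt_le_trans _ y_le0)// -subr_lt0 ev pmulr_llt0 ?subr_gt0//.
rewrite (gpoly_shift (m - P - 1) _ v0) pmulr_rlt0 ?powR_gt0//.
apply: le_lt_trans Hu; apply: gpoly_nincr => //; last exact: ltW.
(* After both shifts and the differentiation a term has coefficient [c.1 * (c.2 - P)] and exponent
   [c.2 - m], so the monotonicity condition is the hypothesis on signs. *)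
move=> _ /mapP[_ /mapP[_ /mapP[c cl ->] ->] ->] /=.
by have := lP _ cl; congr (_ <= 0); ring.
Qed.

Lemma continuous_gpoly l : (forall c, c \in l -> 0 < c.2) ->
  continuous (gpoly l).
Proof.
rewrite /gpoly; elim: l => [_|c l IHl lP].
  rewrite (_ : (fun t => _) = cst 0); first exact: cst_continuous.
  by apply/funext => x; rewrite big_nil.
rewrite [X in continuous X](_ : _ = (fun x => c.1 * `|x| `^ c.2) +
    (fun x => \sum_(c <- l) c.1 * `|x| `^ c.2)); last first.
  by apply/funext => x; rewrite big_cons.
move=> x; apply: continuousD; last first.
  by apply: IHl => d dl; apply: lP; rewrite inE dl orbT.
apply: (@continuousM _ R (cst c.1)); first exact: cst_continuous.
by apply: continuous_norm_powR; apply: lP; rewrite mem_head.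
Qed.

Lemma gprim_exponent_gt0 l : (forall c, c \in l -> 0 < c.2) ->
  forall c, c \in gprim l -> 0 < c.2.
Proof. by move=> lP _ /mapP[c /lP ? ->]. Qed.

Lemma is_derive_gprim l t : (forall c, c \in l -> 0 < c.2) -> 0 < t ->
  is_derive t 1 (gpoly (gprim l)) (gpoly l t / t).
Proof.
move=> lP t0.
rewrite (_ : _ / t = gpoly [seq (c.1 * c.2, c.2 - 1) | c <- gprim l] t).
  exact: is_derive_gpoly.
rewrite (gpoly_shift 1)// powRr1 ?ltW// mulrAC divff ?mul1r ?gt_eqF//.
rewrite /gpoly /gprim !big_map big_seq [RHS]big_seq.
by apply: eq_bigr => c /lP c0 /=; rewrite divfK ?gt_eqF.
Qed.

Lemma gprim_mvt l x y : (forall c, c \in l -> 0 < c.2) -> 0 <= x -> x < y ->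
  exists2 z, x < z < y & gpoly (gprim l) y - gpoly (gprim l) x =
    gpoly l z / z * (y - x).
Proof.
move=> lP x0 xy; have [||z] := @MVT _ (gpoly (gprim l))
    (fun z => gpoly l z / z) _ _ xy.
- move=> z; rewrite in_itv/= => /andP[xz _].
  by apply: is_derive_gprim => //; exact: le_lt_trans xz.
- apply: continuous_subspaceT; apply: continuous_gpoly.
  exact: gprim_exponent_gt0.
- by rewrite in_itv/= => zxy ->; exists z.
Qed.

Lemma gpoly0 l : (forall c, c \in l -> 0 < c.2) -> gpoly l 0 = 0.
Proof.
move=> lP; rewrite /gpoly big_seq big1// => c /lP c0.
by rewrite normr0 powR0 ?mulr0// gt_eqF.
Qed.

(** Positivity is what singles out the maximum: the primitive vanishes at 0, so a positive value at
    1 yields, by the mean value theorem, a point before 1 where [gpoly l] is positive, and from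
    there only one sign change is left, at 1. *)
Lemma gprim_peak (m P : R) l :
  (forall c, c \in l -> 0 < c.2) ->
  (forall c, c \in l -> c.1 * (c.2 - P) * (c.2 - m) <= 0) ->
  gpoly l 1 = 0 -> 0 < gpoly (gprim l) 1 ->
  [/\ forall t, 0 < t -> gpoly (gprim l) t <= gpoly (gprim l) 1,
      forall t, 1 < t -> gpoly l t < 0
    & exists2 x, 0 < x < 1 & forall t, x < t -> t < 1 -> 0 < gpoly l t].
Proof.
move=> lpos lP l1 fl1.
have below x y : 0 < x -> x < y -> y < 1 -> 0 < gpoly l x -> 0 < gpoly l y.
  move=> x0 xy y1 lx; rewrite ltNge; apply/negP => ly.
  by have := gpoly_two_sign_changes lP x0 xy y1 lx ly; rewrite l1 ltxx.
have rise y : 0 < y -> 0 < gpoly (gprim l) y ->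
    exists2 x, 0 < x < y & 0 < gpoly l x.
  move=> y0 ly; have [x /andP[x0 xy]] := gprim_mvt lpos (lexx 0) y0.
  rewrite gpoly0 ?subr0; last exact: gprim_exponent_gt0.
  move=> e; exists x; first by rewrite x0.
  by move: ly; rewrite e pmulr_lgt0// pmulr_lgt0 ?invr_gt0.
have [x /andP[x0 x1] lx] := rise _ ltr01 fl1.
have after t : 1 < t -> gpoly l t < 0.
  by move=> t1; apply: (gpoly_two_sign_changes lP x0 x1 t1 lx); rewrite l1.
split=> //; last first.
  by exists x => [|t xt t1]; [rewrite x0|exact: below xt t1 lx].
move=> t t0; have [t1|t1|->//] := ltgtP t 1; last first.
  have [z /andP[z1 _]] := gprim_mvt lpos ler01 t1.
  move/eqP; rewrite subr_eq => /eqP ->; rewrite gerDr pmulr_lle0 ?subr_gt0//.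
  by rewrite pmulr_lle0 ?ltW ?after// invr_gt0 (lt_trans ltr01).
(* A higher value at [t < 1] makes [gpoly l] positive somewhere before [t], hence up to 1 by
   [below], whereas the descent from [t] to 1 needs a point where it is negative. *)
rewrite leNgt; apply/negP => flt.
have [y /andP[y0 yt] ly] := rise _ t0 (lt_trans fl1 flt).
have [z /andP[tz z1] e] := gprim_mvt lpos (ltW t0) t1.
have z0 := lt_trans t0 tz.
have : gpoly l z < 0.
  rewrite -(@pmulr_llt0 _ (z^-1)) ?invr_gt0//.
  by rewrite -(@pmulr_llt0 _ (1 - t)) ?subr_gt0// -e subr_lt0.
by rewrite ltNge ltW// (below _ _ y0 _ z1 ly)// (lt_trans yt).
Qed.

End GeneralizedPolynomials.

(** * Perturbation of the coefficients along a ray *)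

Section Perturbation.
Context {R : realType}.
(* The entry [((c, d), e)] is a term with exponent [e] whose coefficient [c h]
   has upper right derivative at most [d] at [h = 0]. *)
Variable L : seq ((R -> R) * R * R).

Definition gpoly_at (h : R) : seq (R * R) := [seq (i.1.1 h, i.2) | i <- L].

Lemma cvg_gpoly_at t :
  (forall i, i \in L -> i.1.1 h @[h --> 0^'+] --> i.1.1 0) ->
  gpoly (gpoly_at h) t @[h --> 0^'+] --> gpoly (gpoly_at 0) t.
Proof.
rewrite /gpoly_at /gpoly; elim: L => [_|i L' IHL Lcvg].
  by under eq_fun do rewrite big_nil; rewrite big_nil; exact: cvg_cst.
under eq_fun do rewrite /= big_cons/=; rewrite /= big_cons/=; apply: cvgD.
  by apply: cvgM; [apply: Lcvg; rewrite mem_head|exact: cvg_cst].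
apply: IHL => j jL.
by apply: Lcvg; rewrite inE jL orbT.
Qed.

Lemma gprim_at_bound (e h t : R) : (forall i, i \in L -> 0 < i.2) ->
  0 < t ->
  (forall i, i \in L -> i.1.1 h <= i.1.1 0 + h * (i.1.2 + e)) ->
  gpoly (gprim (gpoly_at h)) t <= gpoly (gprim (gpoly_at 0)) t +
    h * gpoly [seq ((i.1.2 + e) / i.2, i.2) | i <- L] t.
Proof.
rewrite /gprim /gpoly_at /gpoly => + t0.
elim: L => [_ _|i L' IHL Lpos Lle]; first by rewrite /= !big_nil mulr0 addr0.
rewrite /= !big_cons/= mulrDr addrACA; apply: lerD; last first.
  apply: IHL => [j jL|j jL]; first by apply: Lpos; rewrite inE jL orbT.
  by apply: Lle; rewrite inE jL orbT.
rewrite mulrA -mulrDl ler_wpM2r ?powR_ge0//.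
rewrite mulrA -mulrDl ler_wpM2r//; last by apply: Lle; rewrite mem_head.
by rewrite invr_ge0 ltW// Lpos// mem_head.
Qed.

(** The bound must be uniform in [t] because it is applied at a critical point that moves with [h]
    and is known only to lie near 1. *)
Lemma cvg_gprim_at_bound (T : R) : (forall i, i \in L -> 0 < i.2) ->
  (forall i, i \in L -> i.1.1 h @[h --> 0^'+] --> i.1.1 0) -> 0 <= T ->
  exists2 r : R -> R, r h @[h --> 0^'+] --> 0 &
    forall t h, 0 <= t <= T ->
      gpoly (gprim (gpoly_at 0)) t <= gpoly (gprim (gpoly_at h)) t + r h.
Proof.
rewrite /gprim /gpoly_at /gpoly; elim: L => [_ _ _|i L' IHL Lpos Lcvg T0].
  exists (fun=> 0); first exact: cvg_cst.
  by move=> *; rewrite /= !big_nil addr0.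
have [j jL|j jL|//|r r0 rP] := IHL.
- by apply: Lpos; rewrite inE jL orbT.
- by apply: Lcvg; rewrite inE jL orbT.
have i0 : 0 < i.2 by apply: Lpos; rewrite mem_head.
exists (fun h => `|i.1.1 h - i.1.1 0| / i.2 * T `^ i.2 + r h).
  rewrite -[X in _ --> X]add0r; apply: cvgD => //.
  rewrite -[X in _ --> X](mul0r (T `^ i.2)); apply: cvgM; last exact: cvg_cst.
  rewrite -[X in _ --> X](mul0r (i.2^-1)); apply: cvgM; last exact: cvg_cst.
  rewrite -[X in _ --> X](normr0 R); apply: cvg_norm.
  rewrite -[X in _ --> X](subrr (i.1.1 0)).
  by apply: cvgB; [apply: Lcvg; rewrite mem_head|exact: cvg_cst].
move=> t h tT; have /andP[t0 leT] := tT.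
rewrite /= !big_cons/= addrACA; apply: lerD; last exact: rP.
rewrite -lerBlDl -mulrBl -mulrBl ger0_norm//.
apply: le_trans (ler_norm _) _; rewrite !normrM distrC.
rewrite [ `|i.2^-1|]gtr0_norm ?invr_gt0// [ `|t `^ _|]ger0_norm ?powR_ge0//.
apply: ler_wpM2l; first by rewrite mulr_ge0// invr_ge0 ltW.
by rewrite ge0_ler_powR// ?nnegrE// ltW.
Qed.

Lemma near_bound_all (e : R) :
  (forall i, i \in L ->
    \forall h \near 0^'+, i.1.1 h <= i.1.1 0 + h * (i.1.2 + e)) ->
  \forall h \near 0^'+, forall i, i \in L ->
    i.1.1 h <= i.1.1 0 + h * (i.1.2 + e).
Proof.
elim: L => [_|i L' IHL Lle]; first by near=> h.
have Li := Lle _ (mem_head _ _).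
have /IHL LL j : j \in L' -> \forall h \near 0^'+,
    j.1.1 h <= j.1.1 0 + h * (j.1.2 + e).
  by move=> jL; apply: Lle; rewrite inE jL orbT.
near=> h => j; rewrite inE => /predU1P[->|]; first by near: h.
by move: j; near: h.
Unshelve. all: by end_near. Qed.

(* If the critical value at [h = 0] is minimal among the positive critical
   values of the perturbed functions, it has nonnegative derivative in [h]:
   the critical point persists by the intermediate value theorem, and at
   [h = 0] it was a maximum in [t]. *)
Lemma gprim_peak_perturbation (m P : R) :
  (forall i, i \in L -> 0 < i.2) ->
  (forall c, c \in gpoly_at 0 -> c.1 * (c.2 - P) * (c.2 - m) <= 0) ->
  gpoly (gpoly_at 0) 1 = 0 -> 0 < gpoly (gprim (gpoly_at 0)) 1 ->
  (forall i, i \in L -> i.1.1 h @[h --> 0^'+] --> i.1.1 0) ->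
  (forall i, i \in L -> forall e, 0 < e ->
    \forall h \near 0^'+, i.1.1 h <= i.1.1 0 + h * (i.1.2 + e)) ->
  (forall h t, 0 < h -> 0 < t -> gpoly (gpoly_at h) t = 0 ->
    0 < gpoly (gprim (gpoly_at h)) t ->
    gpoly (gprim (gpoly_at 0)) 1 <= gpoly (gprim (gpoly_at h)) t) ->
  0 <= \sum_(i <- L) i.1.2 / i.2.
Proof.
move=> Lpos LP l1 k0 Lcvg Lle Lmin.
have lpos h c : c \in gpoly_at h -> 0 < c.2 by move=> /mapP[i /Lpos ? ->].
rewrite leNgt; apply/negP => E0; set k := gpoly (gprim _) 1 in k0 Lmin.
have [fle neg [x /andP[x0 x1] pos]] := gprim_peak (lpos 0) LP l1 k0.
pose F e t := gpoly [seq ((i.1.2 + e) / i.2, i.2) | i <- L] t.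
(* With [E] the sum assumed negative and [S] the sum of the inverse exponents, the slack
   [e = - E / (2 * (S + 1))] adds [e * S], less than half of [- E]. *)
have [e e0 Fe] : exists2 e, 0 < e & F e 1 < 0.
  pose S := \sum_(i <- L) i.2^-1.
  have S0 : 0 <= S.
    rewrite /S big_seq; apply: sumr_ge0 => i /Lpos i0.
    by rewrite invr_ge0 ltW.
  have FE e : F e 1 = \sum_(i <- L) i.1.2 / i.2 + e * S.
    rewrite /F /gpoly big_map mulr_sumr -big_split; apply: eq_bigr => i _ /=.
    by rewrite normr1 powR1 mulr1 mulrDl.
  move: E0 FE; set E := (X in X < 0) => E0 FE; exists (- E / (2 * (S + 1))).
    by rewrite divr_gt0 ?oppr_gt0// mulr_gt0// ltr_wpDl.
  rewrite FE -[X in X + _]opprK addrC subr_lt0 -mulrA gtr_pMr ?oppr_gt0//.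
  rewrite mulrC ltr_pdivrMr ?mul1r; last by rewrite mulr_gt0// ltr_wpDl.
  lra.
have Fcont : continuous (F e).
  by apply: continuous_gpoly => _ /mapP[i /Lpos ? ->].
have fcont : continuous (gpoly (gprim (gpoly_at 0))).
  by apply/continuous_gpoly/gprim_exponent_gt0/lpos.
have [d /= d0 dP] : exists2 d, 0 < d & forall t, `|1 - t| < d ->
    F e t < 0 /\ k / 2 < gpoly (gprim (gpoly_at 0)) t.
  have : \forall t \near (1 : R),
      F e t < 0 /\ k / 2 < gpoly (gprim (gpoly_at 0)) t.
    apply: filterI; first exact: (cvgr_lt _ (Fcont 1)).
    by apply: (cvgr_gt _ (fcont 1)); rewrite ltr_pdivrMr// ltr_pMr// ltr1n.
  by move=> /nbhs_ballP[d /= d0 dP]; exists d => // t /dP.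
(* The first bound stays in the neighbourhood of 1 given by [dP], the second keeps [t] positive and
   below 2, the third keeps [1 - d'] to the right of [x], where the sign is known. *)
pose d' := Num.min (d / 2) (Num.min (1 / 2) ((1 - x) / 2)).
have d'0 : 0 < d' by rewrite !lt_min; apply/and3P; split; lra.
have : d' <= d / 2 by rewrite ge_min lexx.
have : d' <= 1 / 2 by rewrite !ge_min lexx orbT.
have : d' <= (1 - x) / 2 by rewrite !ge_min lexx !orbT.
move: d' d'0 => d' d'0 d'x d'1 d'd.
have near_near t : 1 - d' <= t <= 1 + d' -> `|1 - t| < d.
  by move=> /andP[? ?]; rewrite ltr_norml; apply/andP; split; lra.
have D1 : 0 < gpoly (gpoly_at 0) (1 - d') by apply: pos; lra.
have D2 : gpoly (gpoly_at 0) (1 + d') < 0 by apply: neg; lra.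
have [r r0 rP] := cvg_gprim_at_bound Lpos Lcvg (ler0n R 2).
apply: (@filter_not_empty _ ((0 : R)^'+)); near=> h.
have h0 : 0 < h by near: h; exact: nbhs_right_gt.
have Dh1 : 0 < gpoly (gpoly_at h) (1 - d').
  near: h; exact: (cvgr_gt _ (cvg_gpoly_at (t := 1 - d') Lcvg)).
have Dh2 : gpoly (gpoly_at h) (1 + d') < 0.
  near: h; exact: (cvgr_lt _ (cvg_gpoly_at (t := 1 + d') Lcvg)).
have [|||t] := @IVT _ (gpoly (gpoly_at h)) (1 - d') (1 + d') 0.
- lra.
- by apply: continuous_subspaceT; apply: continuous_gpoly; exact: lpos.
- by rewrite ge_min le_max (ltW Dh1) (ltW Dh2) orbT.
rewrite in_itv/= => td' Dt.
have t0 : 0 < t by move/andP: td' => -[? ?]; lra.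
have [Ft ft] := dP _ (near_near _ td').
have rh : r h < k / 2.
  near: h; apply: (cvgr_lt _ r0); exact: divr_gt0.
have ft0 : 0 < gpoly (gprim (gpoly_at h)) t.
  have t2 : 0 <= t <= 2 by move/andP: td' => -[? ?]; lra.
  have := rP t h t2; lra.
(* The contradiction is a chain: [k] is at most the value at [(h, t)], which is at most the value at
   [(0, t)] plus the negative [h * F e t], hence less than [k]. *)
have := Lmin _ _ h0 t0 Dt ft0.
have : gpoly (gprim (gpoly_at h)) t <=
    gpoly (gprim (gpoly_at 0)) t + h * F e t.
  apply: gprim_at_bound => //; near: h.
  by apply: near_bound_all => i iL; exact: Lle.
have := fle _ t0; rewrite -/k.
have : h * F e t < 0 by rewrite pmulr_rlt0.
lra.
Unshelve. all: by end_near. Qed.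
End Perturbation.

(** * Weighted graphs *)

Section FiniteSums.
Context {R : realType}.

Lemma is_derive_bigsum {I : eqType} (r : seq I) (F : I -> R -> R) (d : I -> R)
    (t : R) : (forall i, i \in r -> is_derive t 1 (F i) (d i)) ->
  is_derive t 1 (fun x => \sum_(i <- r) F i x) (\sum_(i <- r) d i).
Proof.
elim: r => [_|i r IHr Fd].
  rewrite big_nil (_ : (fun t => _) = cst 0); first exact: is_derive_cst.
  by apply/funext => x; rewrite big_nil.
rewrite big_cons (_ : (fun x => _) = F i + (fun x => \sum_(i <- r) F i x)).
  apply: is_deriveD; first by apply: Fd; rewrite mem_head.
  by apply: IHr => j jr; apply: Fd; rewrite inE jr orbT.
by apply/funext => x; rewrite big_cons.
Qed.

Lemma continuous_bigsum {T : topologicalType} {I : eqType} (r : seq I)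
    (F : I -> T -> R) : (forall i, i \in r -> continuous (F i)) ->
  continuous (fun x => \sum_(i <- r) F i x).
Proof.
elim: r => [_|i r IHr Fc].
  rewrite (_ : (fun t => _) = cst 0); first exact: cst_continuous.
  by apply/funext => x; rewrite big_nil.
rewrite (_ : (fun x => _) = F i + (fun x => \sum_(i <- r) F i x)); last first.
  by apply/funext => x; rewrite big_cons.
move=> x; apply: continuousD; first by apply: Fc; rewrite mem_head.
by apply: IHr => j jr; apply: Fc; rewrite inE jr orbT.
Qed.

(* The form [Q0 + 2 h Q1 + h ^ 2 Q2] is the square of a seminorm along a line;
   when [Q0 = 0] the Cauchy-Schwarz inequality forces [Q1 = 0]. *)
Lemma is_derive_sqrt_powR (p Q0 Q1 Q2 : R) : 1 < p ->
  (Q0 = 0 -> Q1 = 0) -> 0 <= Q0 -> 0 <= Q2 ->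
  is_derive (0 : R) 1 (fun h => Num.sqrt (Q0 + 2 * h * Q1 + h ^+ 2 * Q2) `^ p)
    (p * (Num.sqrt Q0 `^ (p - 2) * Q1)).
Proof.
move=> p1 Q01 + Q2ge0; rewrite le_eqVlt => /predU1P[/esym Q00|Q0_gt0].
  rewrite Q01// Q00 sqrtr0 (_ : (fun h => _) =
      Num.sqrt Q2 `^ p \*: (fun h => `|h| `^ p)); last first.
    apply/funext => h; rewrite mulr0 !add0r sqrtrM ?sqr_ge0// sqrtr_sqr.
    by rewrite powRM// mulrC.
  have := is_deriveZ (Num.sqrt Q2 `^ p)
    (is_derive_norm_powR (a := p) (t := 0) (introT orP (or_introl p1))).
  by move=> H; apply: (@is_derive_eq _ _ _ _ _ _ _ _ H); rewrite !mulr0 scaler0.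
have D : is_derive (0 : R) 1 (fun h => Q0 + 2 * h * Q1 + h ^+ 2 * Q2) (2 * Q1).
  have -> : (fun h => Q0 + 2 * h * Q1 + h ^+ 2 * Q2) =
      (cst Q0 + (2 * Q1) \*: id + Q2 \*: (id * id)).
    apply/funext => h; transitivity (Q0 + (2 * Q1) * h + Q2 * (h * h)) => //.
    by ring.
  have := is_deriveD (is_deriveD (is_derive_cst Q0 (0 : R) 1)
    (is_deriveZ (2 * Q1) (is_derive_id (0 : R) 1)))
    (is_deriveZ Q2 (is_deriveM (is_derive_id (0 : R) 1)
      (is_derive_id (0 : R) 1))).
  move=> H; apply: (@is_derive_eq _ _ _ _ _ _ _ _ H).
  rewrite add0r -[X in X + _]/(2 * Q1 * 1) -[X in _ + X]/(Q2 * (0 * 1 + 0 * 1)).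
  by ring.
have := is_derive1_comp (f := @powR R ^~ (p / 2)) _ D.
rewrite mulr0 mul0r addr0 expr0n mul0r addr0.
move=> /(_ _ (is_derive1_powR (p / 2) Q0_gt0)).
rewrite (_ : _ * (2 * Q1) = p * (Num.sqrt Q0 `^ (p - 2) * Q1)); last first.
  rewrite -powR12_sqrt ?ltW// -powRrM (_ : p / 2 - 1 = 2^-1 * (p - 2)).
    by field.
  by field.
apply: near_eq_is_derive; near=> h => /=.
have Qh : 0 < Q0 + 2 * h * Q1 + h ^+ 2 * Q2.
  near: h.
  have [/derivable1_diffP/differentiable_continuous Dc _] := D.
  by apply: (cvgr_gt _ Dc); rewrite mulr0 mul0r addr0 expr0n mul0r addr0.
by rewrite -powR12_sqrt ?ltW// -powRrM (mulrC p).
Unshelve. all: by end_near. Qed.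

End FiniteSums.

(** * Calculus on a locally finite graph *)

Section WeightedGraph.
Context {R : realType} {V : choiceType}.
Variable G : wgraph R V.
Hypothesis hG : locally_finite G.
Implicit Types (A Omega : set V) (u v w phi : V -> R) (x y : V).

Lemma mu_gt0 x : 0 < mu G x.
Proof. by have [m m0 /(_ x)] := mu_bounded_below G; exact: lt_le_trans. Qed.

Lemma finite_ball x n : finite_set
  [set y | exists2 t : seq V, path (adj G) x t /\ last x t = y & (size t <=
      n)%N].
Proof.
elim: n => [|n IHn].
  apply: (@sub_finite_set _ _ [set x]); last exact: finite_set1.
  by move=> y [[|//] [_ /= <-]].
have Bfin := bigcup_finite IHn (fun z _ => hG z).
apply: (@sub_finite_set _ _ (_ `|` _)); last first.
  by rewrite finite_setU; split; [exact: IHn|exact: Bfin].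
move=> y [t [pt <-] st] /=.
case/lastP: t pt st => [|t z]; first by left; exists [::].
rewrite rcons_path size_rcons last_rcons => /andP[pt az] st; right.
by exists (last x t) => //; exists t.
Qed.

Lemma finite_bounded_domain A : bounded_domain G A -> finite_set A.
Proof.
move=> [D AD]; have [->|/set0P[x Ax]] := eqVneq A set0; first exact:
    finite_set0.
have [n Dn] : exists n : nat, D < n%:R.
  by exists (Num.trunc D).+1; exact: truncnS_gt.
apply: (sub_finite_set _ (finite_ball x n)) => y Ay.
have : (gdist G x y < (n%:R)%:E)%E.
  by apply: le_lt_trans (AD _ _ Ax Ay) _; rewrite lte_fin.
move=> /ereal_inf_lt[_ [t pt <-]]; rewrite lte_fin ltr_nat => tn.
by exists t => //; exact: ltnW.
Qed.

Lemma integral_onE A u : finite_set A ->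
  integral_on G A u = \sum_(x <- fset_set A) u x * mu G x.
Proof. exact: fsbig_finite. Qed.

Lemma lapE u x :
  lap G u x = (mu G x)^-1 * \sum_(y <- fset_set (nbr G x))
    (weight G x y * (u y - u x)).
Proof. by rewrite /lap fsbig_finite. Qed.

Lemma GamE u v x :
  Gam G u v x = (2 * mu G x)^-1 * \sum_(y <- fset_set (nbr G x))
    (weight G x y * (u y - u x) * (v y - v x)).
Proof. by rewrite /Gam fsbig_finite. Qed.

Lemma eq_integral_on A u v : (forall x, A x -> u x = v x) ->
  integral_on G A u = integral_on G A v.
Proof. by move=> uv; apply: eq_fsbigr => x /set_mem /uv ->. Qed.

Lemma le_integral_on A u v : finite_set A -> (forall x, A x -> u x <= v x) ->
  integral_on G A u <= integral_on G A v.
Proof.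
move=> Afin uv; rewrite !integral_onE// big_seq [leRHS]big_seq.
apply: ler_sum => x; rewrite in_fset_set// => /set_mem Ax.
by rewrite ler_wpM2r ?uv// ltW ?mu_gt0.
Qed.

Lemma integral_on_ge0 A u : (forall x, A x -> 0 <= u x) -> 0 <= integral_on G A
    u.
Proof.
by move=> u0; apply: fsumr_ge0 => x Ax; rewrite mulr_ge0 ?u0// ltW ?mu_gt0.
Qed.

Lemma integral_onD A u v : finite_set A ->
  integral_on G A (fun x => u x + v x) = integral_on G A u + integral_on G A v.
Proof.
move=> Afin; rewrite !integral_onE// -big_split; apply: eq_bigr => x _.
exact: mulrDl.
Qed.

Lemma integral_onZ A (k : R) u :
  integral_on G A (fun x => k * u x) = k * integral_on G A u.
Proof.
by rewrite /integral_on mulr_fsumr; apply: eq_fsbigr => x _; rewrite mulrA.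
Qed.

Lemma integral_on_ge_term A u x : finite_set A -> A x ->
  (forall y, A y -> 0 <= u y) -> u x * mu G x <= integral_on G A u.
Proof.
move=> Afin Ax u0; rewrite /integral_on (fsbigD1 x)//= lerDl.
by apply: fsumr_ge0 => y [Ay _]; rewrite mulr_ge0 ?u0// ltW ?mu_gt0.
Qed.

Lemma integral_on_gt0 A u x : finite_set A -> (forall y, A y -> 0 <= u y) ->
  A x -> 0 < u x -> 0 < integral_on G A u.
Proof.
move=> Afin u0 Ax ux; apply: lt_le_trans (integral_on_ge_term Afin Ax u0).
by rewrite mulr_gt0 ?mu_gt0.
Qed.

Lemma integral_on_change1 A u v x : finite_set A -> A x ->
  (forall y, y != x -> u y = v y) ->
  integral_on G A u = integral_on G A v + (u x - v x) * mu G x.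
Proof.
move=> Afin Ax uv; rewrite /integral_on (fsbigD1 x)//= [in RHS](fsbigD1 x)//=.
rewrite (eq_fsbigr (fun y => v y * mu G y)); first by ring.
by move=> y /set_mem[_ /eqP yx]; rewrite uv.
Qed.

Lemma lap_linear (a : R) u v :
  lap G (fun x => a * u x + v x) = fun x => a * lap G u x + lap G v x.
Proof.
apply/funext => x; rewrite !lapE mulrCA -mulrDr; congr (_ * _).
rewrite mulr_sumr -big_split; apply: eq_bigr => y _ /=; ring.
Qed.

Lemma iter_lap_linear n (a : R) u v :
  iter n (lap G) (fun x => a * u x + v x) =
  fun x => a * iter n (lap G) u x + iter n (lap G) v x.
Proof. by elim: n => //= n ->; rewrite lap_linear. Qed.

Lemma Gam_sym u v x : Gam G u v x = Gam G v u x.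
Proof.
rewrite !GamE; congr (_ * _); apply: eq_bigr => y _; ring.
Qed.

Lemma Gam_linear (a : R) u v w x :
  Gam G u (fun y => a * v y + w y) x = a * Gam G u v x + Gam G u w x.
Proof.
rewrite !GamE mulrCA -mulrDr; congr (_ * _).
rewrite mulr_sumr -big_split; apply: eq_bigr => y _ /=; ring.
Qed.

Lemma weight_nbr_gt0 x y : y \in fset_set (nbr G x) -> 0 < weight G x y.
Proof. by rewrite in_fset_set// => /set_mem; exact: weight_gt0. Qed.

Lemma Gam_ge0 u x : 0 <= Gam G u u x.
Proof.
rewrite GamE; apply: mulr_ge0; first by rewrite invr_ge0 mulr_ge0// ltW ?mu_gt0.
rewrite big_seq; apply: sumr_ge0 => y yx.
by rewrite -mulrA; apply: mulr_ge0; [exact/ltW/weight_nbr_gt0|exact: sqr_ge0].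
Qed.

Lemma Gam_eq0 u v x : Gam G u u x = 0 -> Gam G u v x = 0.
Proof.
rewrite !GamE => /eqP; rewrite mulf_eq0 invr_eq0 gt_eqF ?mulr_gt0 ?mu_gt0//=.
rewrite big_seq psumr_eq0 => [/allP H|y yx]; last first.
  by rewrite -mulrA; apply: mulr_ge0; [exact/ltW/weight_nbr_gt0|exact: sqr_ge0].
rewrite big_seq big1 ?mulr0// => y yx; have := H _ yx; rewrite yx/=.
rewrite -mulrA !mulf_eq0 orbb (gt_eqF (weight_nbr_gt0 yx))/= => /eqP ->.
by rewrite mulr0 mul0r.
Qed.

(** The bilinear form whose diagonal is the square of [gradm m u x]; it hides the parity of [m] from
    the Dirichlet energy and its derivative. *)
Definition gform m u v x : R :=
  if odd m then Gam G (iter m./2 (lap G) u) (iter m./2 (lap G) v) x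
  else iter m./2 (lap G) u x * iter m./2 (lap G) v x.

Lemma gradmE m u x : gradm G m u x = Num.sqrt (gform m u u x).
Proof. by rewrite /gradm /gform; case: ifP => // _; rewrite -expr2 sqrtr_sqr.
    Qed.

Lemma gform_sym m u v x : gform m u v x = gform m v u x.
Proof. by rewrite /gform Gam_sym mulrC. Qed.

Lemma gform_linear m (a : R) u v w x :
  gform m u (fun y => a * v y + w y) x = a * gform m u v x + gform m u w x.
Proof.
rewrite /gform iter_lap_linear; case: ifP => _; first exact: Gam_linear.
ring.
Qed.

Lemma gform_ge0 m u x : 0 <= gform m u u x.
Proof.
by rewrite /gform; case: ifP => _; [exact: Gam_ge0|rewrite -expr2 sqr_ge0].
Qed.

(** The degenerate case of Cauchy-Schwarz: for odd [m] a vanishing sum of nonnegative edge terms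
    vanishes edge by edge. It supplies the condition [Q0 = 0 -> Q1 = 0] of [is_derive_sqrt_powR] at
    the zeros of the gradient. *)
Lemma gform_eq0 m u v x : gform m u u x = 0 -> gform m u v x = 0.
Proof.
rewrite /gform; case: ifP => _; first exact: Gam_eq0.
by move=> /eqP; rewrite mulf_eq0 orbb => /eqP ->; rewrite mul0r.
Qed.

Lemma gform0l m v x : gform m (fun=> 0) v x = 0.
Proof.
rewrite gform_eq0// /gform iter_lap_cst0 GamE mul0r.
by rewrite big1 ?mulr0 ?if_same// => y _; rewrite subrr !mulr0.
Qed.

Lemma gform_line m u v x (h : R) :
  gform m (fun y => u y + h * v y) (fun y => u y + h * v y) x =
  gform m u u x + 2 * h * gform m u v x + h ^+ 2 * gform m v v x.
Proof.
under [fun y => u y + _]eq_fun do rewrite addrC.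
set U := fun y => _ + _.
have E w : gform m w U x = h * gform m w v x + gform m w u x.
  exact: gform_linear.
rewrite E (gform_sym m U v) (gform_sym m U u) !E (gform_sym m v u); ring.
Qed.

Lemma gradm_scale m (t : R) u x :
  gradm G m (fun y => t * u y) x = `|t| * gradm G m u x.
Proof.
rewrite !gradmE; have -> : (fun y => t * u y) = (fun y => (fun=> 0) y + t * u
    y).
  by apply/funext => y; rewrite add0r.
rewrite gform_line.
by rewrite !gform0l mulr0 !add0r sqrtrM ?sqr_ge0// sqrtr_sqr.
Qed.

Lemma pounds_formE Omega m s u phi : pounds_form G Omega m s u phi =
  integral_on G (clos G Omega)
    (fun x => gradm G m u x `^ (s - 2) * gform m u phi x).
Proof. by []. Qed.

Lemma pounds_form_linear Omega m s u (a : R) v w :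
  finite_set (clos G Omega) ->
  pounds_form G Omega m s u (fun y => a * v y + w y) =
  a * pounds_form G Omega m s u v + pounds_form G Omega m s u w.
Proof.
move=> Ofin; rewrite !pounds_formE -integral_onZ -integral_onD//.
by apply: eq_integral_on => x _; rewrite gform_linear; ring.
Qed.

Lemma pounds_formZ Omega m s u (a : R) v : finite_set (clos G Omega) ->
  pounds_form G Omega m s u (fun y => a * v y) =
  a * pounds_form G Omega m s u v.
Proof.
move=> Ofin; have P0 : pounds_form G Omega m s u (fun=> 0) = 0.
  have := pounds_form_linear m s u (-1) (fun=> 0) (fun=> 0) Ofin.
  by rewrite mulr0 addr0 mulN1r addNr.
have := pounds_form_linear m s u a v (fun=> 0) Ofin.
rewrite P0 addr0 => <-; congr (pounds_form _ _ _ _ _ _).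
by apply/funext => y; rewrite addr0.
Qed.

Lemma pounds_form0l Omega m s phi : pounds_form G Omega m s (fun=> 0) phi = 0.
Proof.
rewrite pounds_formE /integral_on fsbig1// => x _.
by rewrite gform0l mulr0 mul0r.
Qed.

(* The [s]-th power of [W0norm]. *)
Definition dirichlet Omega (m : nat) (s : R) u : R :=
  integral_on G (clos G Omega) (fun x => gradm G m u x `^ s).

Lemma dirichlet_ge0 Omega m s u : 0 <= dirichlet Omega m s u.
Proof. by apply: integral_on_ge0 => x _; rewrite powR_ge0. Qed.

Lemma dirichletE Omega m s u : s != 0 ->
  dirichlet Omega m s u = W0norm G Omega m s u `^ s.
Proof. by move=> s0; rewrite -powRrM mulVf// powRr1// dirichlet_ge0. Qed.

Lemma gradm_ge0 m u x : 0 <= gradm G m u x.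
Proof. by rewrite gradmE sqrtr_ge0. Qed.

Lemma dirichlet_scale Omega m s (t : R) u :
  dirichlet Omega m s (fun y => t * u y) = `|t| `^ s * dirichlet Omega m s u.
Proof.
rewrite -integral_onZ; apply: eq_integral_on => x _.
by rewrite gradm_scale powRM// gradm_ge0.
Qed.

Lemma W0norm_scale Omega m s (t : R) u : s != 0 ->
  W0norm G Omega m s (fun y => t * u y) = `|t| * W0norm G Omega m s u.
Proof.
move=> s0; rewrite /W0norm -!/(dirichlet _ _ _ _) dirichlet_scale.
by rewrite powRM ?powR_ge0 ?dirichlet_ge0// -powRrM divff// powRr1.
Qed.

(** By [gform_line] each vertex contributes a power of the square root of a quadratic in [h]. This
    identifies [pounds_form] as the differential of the Dirichlet energy divided by [s]. *)
Lemma is_derive_dirichlet Omega m s u v : finite_set (clos G Omega) -> 1 < s ->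
  is_derive (0 : R) 1 (fun h => dirichlet Omega m s (fun y => u y + h * v y))
    (s * pounds_form G Omega m s u v).
Proof.
move=> Ofin s1; rewrite pounds_formE -integral_onZ integral_onE//.
under eq_fun do rewrite /dirichlet integral_onE//.
apply: is_derive_bigsum => x _; rewrite mulrC.
rewrite (_ : (fun h => _) = mu G x \*: (fun h : R => Num.sqrt (gform m u u x +
    2 * h * gform m u v x + h ^+ 2 * gform m v v x) `^ s)).
  apply: is_deriveZ; rewrite gradmE.
  by apply: is_derive_sqrt_powR; rewrite ?gform_ge0//; exact: gform_eq0.
by apply/funext => h; rewrite mulrC gradmE gform_line.
Qed.

(** Under pointwise convergence Tychonoff's theorem gives compactness, so no coordinates on the
    finite dimensional space [Cc Omega] have to be chosen. *)
Let T := prod_topology (fun _ : V => (R : topologicalType)).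

Lemma continuous_iter_lap n x :
  continuous (fun u : T => iter n (lap G) u x).
Proof.
elim: n x => [|n IHn] x; first exact: proj_continuous.
rewrite (_ : (fun u => _) = (fun u : T => (mu G x)^-1 *
  \sum_(y <- fset_set (nbr G x))
    (weight G x y * (iter n (lap G) u y - iter n (lap G) u x)))); last first.
  by apply/funext => u /=; rewrite lapE.
move=> u; apply: (@continuousM _ T (cst _)); first exact: cst_continuous.
apply: continuous_bigsum => y _ {}u.
apply: (@continuousM _ T (cst _)); first exact: cst_continuous.
by apply: continuousB; exact: IHn.
Qed.

Lemma continuous_gform m x : continuous (fun u : T => gform m u u x).
Proof.
rewrite /gform; case: (odd m) => u; last first.
  by apply: continuousM; exact: continuous_iter_lap.
rewrite (_ : (fun u => _) = (fun u : T => (2 * mu G x)^-1 *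
    \sum_(y <- fset_set (nbr G x)) (weight G x y *
      (iter m./2 (lap G) u y - iter m./2 (lap G) u x) *
      (iter m./2 (lap G) u y - iter m./2 (lap G) u x)))); last first.
  by apply/funext => w; rewrite GamE.
apply: (@continuousM _ T (cst _)); first exact: cst_continuous.
apply: continuous_bigsum => y _ {}u.
have cB : {for u, continuous
    (fun u : T => iter m./2 (lap G) u y - iter m./2 (lap G) u x)}.
  by apply: continuousB; exact: continuous_iter_lap.
apply: (@continuousM _ T _ _ _ _ cB).
by apply: (@continuousM _ T (cst _) _ _ _ cB); exact: cst_continuous.
Qed.

Lemma continuous_dirichlet Omega m s : finite_set (clos G Omega) -> 0 < s ->
  continuous (fun u : T => dirichlet Omega m s u).
Proof.
move=> Ofin s0; rewrite (_ : (fun u => _) = (fun u : T =>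
    \sum_(x <- fset_set (clos G Omega))
      `|Num.sqrt (gform m u u x)| `^ s * mu G x)); last first.
  apply/funext => u; rewrite /dirichlet integral_onE//.
  by apply: eq_bigr => x _; rewrite ger0_norm ?sqrtr_ge0// gradmE.
apply: continuous_bigsum => x _ u.
apply: (@continuousM _ T _ (cst _)); last exact: cst_continuous.
apply: (@continuous_comp _ _ _ (fun u : T => Num.sqrt (gform m u u x))
  (fun t : R => `|t| `^ s)); last exact: continuous_norm_powR.
apply: (@continuous_comp _ _ _ (fun u : T => gform m u u x) Num.sqrt).
  exact: continuous_gform.
exact: sqrt_continuous.
Qed.

End WeightedGraph.

(** * The coupled system *)

Section OneSidedBounds.
Context {R : realType}.
Implicit Types (f : R -> R) (d e t a k sg : R).

Lemma is_derive_right_cvg f d : is_derive (0 : R) 1 f d ->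
  f h @[h --> 0^'+] --> f 0.
Proof.
move=> [/derivable1_diffP/differentiable_continuous fc _].
exact: (cvg_at_right_filter fc).
Qed.

Lemma is_derive_right_le f d e : is_derive (0 : R) 1 f d -> 0 < e ->
  \forall h \near 0^'+, f h <= f 0 + h * (d + e).
Proof.
move=> /right_derivative fd e0; near=> h.
have h0 : 0 < h by near: h; exact: nbhs_right_gt.
have : (f h - f 0) / h < d + e.
  by near: h; apply: (cvgr_lt _ fd); rewrite ltrDl.
by rewrite ltr_pdivrMr// mulrC -lerBlDl => /ltW.
Unshelve. all: by end_near. Qed.

Lemma is_derive_right_ge f d e : is_derive (0 : R) 1 f d -> 0 < e ->
  \forall h \near 0^'+, f 0 + h * (d - e) <= f h.
Proof.
move=> /right_derivative fd e0; near=> h.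
have h0 : 0 < h by near: h; exact: nbhs_right_gt.
have : d - e < (f h - f 0) / h.
  by near: h; apply: (cvgr_gt _ fd); rewrite ltrBlDl ltrDr.
by rewrite ltr_pdivlMr// mulrC -lerBrDl => /ltW.
Unshelve. all: by end_near. Qed.

Lemma is_derive_line_powR C k a t sg : (1 < a) || (t != 0) ->
  is_derive (0 : R) 1 (fun h => C + k * `|t + h * sg| `^ a)
    (k * (a * (`|t| `^ (a - 2) * t) * sg)).
Proof.
move=> at0; pose g := (fun h : R => t + h * sg).
have gd : is_derive (0 : R) 1 g sg.
  rewrite (_ : g = cst t + sg \*: id); last first.
    by apply/funext => h; rewrite /g mulrC.
  have := is_deriveD (is_derive_cst t (0 : R) 1)
    (is_deriveZ sg (is_derive_id (0 : R) 1)).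
  by move=> H; apply: (@is_derive_eq _ _ _ _ _ _ _ _ H); rewrite add0r; exact:
      mulr1.
have g0 : g 0 = t by rewrite /g mul0r addr0.
have pd : is_derive (g 0) 1 (fun x : R => `|x| `^ a) (a * (`|t| `^ (a - 2) *
    t)).
  by rewrite g0; exact: is_derive_norm_powR.
have := is_deriveD (is_derive_cst C (0 : R) 1)
  (is_deriveZ k (is_derive1_comp pd gd)).
by move=> H; apply: (@is_derive_eq _ _ _ _ _ _ _ _ H); rewrite add0r.
Qed.

End OneSidedBounds.

(* The data of one of the two equations: order, exponent of the operator,
   parameters of the concave term and exponent of the coupling. *)
Record side (R : realType) (V : choiceType) := Side {
  ord : nat;
  expo : R;
  gam : R;
  lam : R;
  pot : V -> R;
  cexp : R }.

Section System.
Context {R : realType} {V : choiceType}.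
Variables (G : wgraph R V) (Omega : set V).
Hypothesis hG : locally_finite G.
Hypothesis Ofin : finite_set (clos G Omega).
Variables (s : R) (c : V -> R).
Hypothesis c_gt0 : forall x, Omega x -> 0 < c x.
Implicit Types (a b : side R V) (u v : V -> R) (x : V).

Definition power_integral (h : V -> R) (g : R) u : R :=
  integral_on G Omega (fun x => h x * `|u x| `^ g).

Definition coupling (al be : R) u v : R :=
  integral_on G Omega (fun x => c x * `|u x| `^ al * `|v x| `^ be).

(** Each coefficient is that of the energy times its exponent: the list itself then gives the Nehari
    functional along the ray of [(u, v)], and its [gprim] the energy. *)
Definition terms a b u v : seq (R * R) :=
  [:: (dirichlet G Omega (ord a) (expo a) u, expo a);
      (dirichlet G Omega (ord b) (expo b) v, expo b);
      (- (lam a * power_integral (pot a) (gam a) u), gam a);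
      (- (lam b * power_integral (pot b) (gam b) v), gam b);
      (- coupling (cexp a) (cexp b) u v, s)].

(** Deliberately one-sided: [side_ok a b] together with [side_ok b a] carries the full hypotheses
    and is stable under exchange, so that one proof serves both equations. *)
Definition side_ok a b :=
  [/\ 1 < gam a, gam a < expo a, gam a < expo b & expo a < s] /\
  [/\ 0 < cexp a, 0 < lam a & forall x, Omega x -> 0 < pot a x].

Lemma finite_Omega : finite_set Omega.
Proof. by apply: sub_finite_set Ofin; exact: subsetUl. Qed.

Lemma power_integral_ge0 h g u : (forall x, Omega x -> 0 < h x) ->
  0 <= power_integral h g u.
Proof.
move=> h0; apply: integral_on_ge0 => x Ox.
by rewrite mulr_ge0 ?powR_ge0// ltW ?h0.
Qed.

Lemma coupling_ge0 al be u v : 0 <= coupling al be u v.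
Proof.
by apply: integral_on_ge0 => x Ox; rewrite !mulr_ge0 ?powR_ge0// ltW ?c_gt0.
Qed.

Lemma couplingC al be u v : coupling al be u v = coupling be al v u.
Proof. by apply: eq_integral_on => x _; rewrite mulrAC. Qed.

Lemma gpoly_terms a b u v t : gpoly (terms a b u v) t =
  dirichlet G Omega (ord a) (expo a) u * `|t| `^ expo a +
  dirichlet G Omega (ord b) (expo b) v * `|t| `^ expo b -
  lam a * power_integral (pot a) (gam a) u * `|t| `^ gam a -
  lam b * power_integral (pot b) (gam b) v * `|t| `^ gam b -
  coupling (cexp a) (cexp b) u v * `|t| `^ s.
Proof. by rewrite /gpoly !big_cons big_nil /=; ring. Qed.

Lemma gprim_terms a b u v t : gpoly (gprim (terms a b u v)) t =
  dirichlet G Omega (ord a) (expo a) u / expo a * `|t| `^ expo a +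
  dirichlet G Omega (ord b) (expo b) v / expo b * `|t| `^ expo b -
  lam a * power_integral (pot a) (gam a) u / gam a * `|t| `^ gam a -
  lam b * power_integral (pot b) (gam b) v / gam b * `|t| `^ gam b -
  coupling (cexp a) (cexp b) u v / s * `|t| `^ s.
Proof. by rewrite /gpoly !big_cons big_nil /=; ring. Qed.

Definition system_energy a b u v := gpoly (gprim (terms a b u v)) 1.

Definition nehari a b u v := gpoly (terms a b u v) 1.

Lemma system_energyC a b u v : system_energy a b u v = system_energy b a v u.
Proof. by rewrite /system_energy !gprim_terms couplingC; ring. Qed.

Lemma nehariC a b u v : nehari a b u v = nehari b a v u.
Proof. by rewrite /nehari !gpoly_terms couplingC; ring. Qed.

Lemma power_integral_scale h g u t :
  power_integral h g (fun y => t * u y) = `|t| `^ g * power_integral h g u.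
Proof.
rewrite -integral_onZ; apply: eq_integral_on => x _.
by rewrite normrM powRM// mulrCA.
Qed.

Lemma coupling_scale al be u v t : al + be = s -> t != 0 ->
  coupling al be (fun y => t * u y) (fun y => t * v y) =
  `|t| `^ s * coupling al be u v.
Proof.
move=> <- t0; rewrite -integral_onZ; apply: eq_integral_on => x _.
rewrite !normrM !powRM// powRD; first by ring.
by rewrite normr_eq0 t0 implybT.
Qed.

Lemma system_energy_scale a b u v t : cexp a + cexp b = s -> t != 0 ->
  system_energy a b (fun y => t * u y) (fun y => t * v y) =
  gpoly (gprim (terms a b u v)) t.
Proof.
move=> cs t0; rewrite /system_energy !gprim_terms !dirichlet_scale//.
rewrite !power_integral_scale coupling_scale// normr1 !powR1; ring.
Qed.

Lemma nehari_scale a b u v t : cexp a + cexp b = s -> t != 0 ->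
  nehari a b (fun y => t * u y) (fun y => t * v y) = gpoly (terms a b u v) t.
Proof.
move=> cs t0; rewrite /nehari !gpoly_terms !dirichlet_scale//.
rewrite !power_integral_scale coupling_scale// normr1 !powR1; ring.
Qed.

Lemma terms_exponent_gt0 a b u v : side_ok a b -> side_ok b a ->
  forall i, i \in terms a b u v -> 0 < i.2.
Proof.
move=> [[ga1 ga gb sa] _] [[gb1 gb' _ sb] _] i; rewrite !inE.
by move=> /or4P[|||/orP[]] /eqP ->/=; lra.
Qed.

(** With [P] the maximum and [m] the minimum, [(e - P) * (e - m)] vanishes at the operator
    exponents, which are the endpoints of [[m, P]], and is positive at the other exponents, whose
    coefficients are nonpositive. *)
Lemma terms_signs a b u v : side_ok a b -> side_ok b a ->
  forall i, i \in terms a b u v ->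
  i.1 * (i.2 - Num.max (expo a) (expo b)) * (i.2 - Num.min (expo a) (expo b))
    <= 0.
Proof.
move=> [[ga1 ga gb sa] [_ la ha]] [[gb1 gb' gab sb] [_ lb hb]] i.
set P := Num.max _ _; set m := Num.min _ _.
have [Pa Pb] : expo a <= P /\ expo b <= P by rewrite !le_max !lexx orbT.
have [ma mb] : m <= expo a /\ m <= expo b by rewrite !ge_min !lexx orbT.
have Ps : P < s by rewrite gt_max sa.
have [gma gmb] : gam a < m /\ gam b < m by rewrite !lt_min; split; apply/andP.
have Ag := dirichlet_ge0 G Omega (ord a) (expo a) u.
have Bg := dirichlet_ge0 G Omega (ord b) (expo b) v.
have Hg := mulr_ge0 (ltW la) (power_integral_ge0 (gam a) u ha).
have Jg := mulr_ge0 (ltW lb) (power_integral_ge0 (gam b) v hb).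
have Kg := coupling_ge0 (cexp a) (cexp b) u v.
rewrite !inE => /or4P[|||/orP[]] /eqP ->/=.
- by rewrite mulr_le0_ge0 ?mulr_ge0_le0 ?subr_le0 ?subr_ge0.
- by rewrite mulr_le0_ge0 ?mulr_ge0_le0 ?subr_le0 ?subr_ge0.
- by rewrite mulr_ge0_le0 ?mulr_le0 ?oppr_le0 ?subr_le0//; lra.
- by rewrite mulr_ge0_le0 ?mulr_le0 ?oppr_le0 ?subr_le0//; lra.
- by rewrite mulr_le0_ge0 ?mulr_le0_ge0 ?oppr_le0 ?subr_ge0//; lra.
Qed.

Definition bump x : V -> R := fun y => (y == x)%:R.

Definition nehari_minimizer a b u v :=
  [/\ Cc Omega u /\ Cc Omega v, nehari a b u v = 0, 0 < system_energy a b u v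
    & forall u' v', Cc Omega u' -> Cc Omega v' -> nehari a b u' v' = 0 ->
      0 < system_energy a b u' v' ->
      system_energy a b u v <= system_energy a b u' v'].

Lemma nehari_minimizerC a b u v : nehari_minimizer a b u v ->
  nehari_minimizer b a v u.
Proof.
move=> [[uC vC] n0 e0 emin]; split => //; first by rewrite nehariC.
- by rewrite system_energyC.
- move=> v' u' v'C u'C; rewrite nehariC ![system_energy b a _ _]system_energyC.
  by move=> *; exact: emin.
Qed.

Lemma Cc_add u x sg h : Omega x -> Cc Omega u ->
  Cc Omega (fun y => u y + h * (sg * bump x y)).
Proof.
move=> Ox uC y Oy; rewrite uC// /bump; case: eqP => [yx|_].
  by move: Oy; rewrite yx.
by rewrite !mulr0 addr0.
Qed.

(** Isolating the vertex [x] leaves a constant plus a multiple of [|u x + k * sg| ^ g], the shape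
    that [is_derive_line_powR] differentiates. *)
Lemma power_integral_bump h g u x sg k : Omega x ->
  power_integral h g (fun y => u y + k * (sg * bump x y)) =
  power_integral h g u - h x * `|u x| `^ g * mu G x +
  mu G x * h x * `|u x + k * sg| `^ g.
Proof.
move=> Ox; rewrite /power_integral (integral_on_change1 G
  (v := fun y => h y * `|u y| `^ g) finite_Omega Ox).
  by rewrite /bump eqxx mulr1; ring.
by move=> y /negbTE yx; rewrite /bump yx !mulr0 addr0.
Qed.

Lemma coupling_bump al be u v x sg k : Omega x ->
  coupling al be (fun y => u y + k * (sg * bump x y)) v =
  coupling al be u v - c x * `|u x| `^ al * `|v x| `^ be * mu G x +
  mu G x * c x * `|v x| `^ be * `|u x + k * sg| `^ al.
Proof.
move=> Ox; rewrite /coupling (integral_on_change1 G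
  (v := fun y => c y * `|u y| `^ al * `|v y| `^ be) finite_Omega Ox).
  by rewrite /bump eqxx mulr1; ring.
by move=> y /negbTE yx; rewrite /bump yx !mulr0 addr0.
Qed.

(** Of the coupling only continuity and a lower slope [k] in the direction [sg * bump x] are asked,
    which covers the smooth case and the cusp alike: its term enters with a minus sign, and
    [gprim_peak_perturbation] wants upper slopes. The conclusion sums the slopes divided by their
    exponents, as in the energy. *)
Lemma nehari_minimizer_direction a b u v x sg k :
  cexp a + cexp b = s -> side_ok a b -> side_ok b a ->
  nehari_minimizer a b u v -> Omega x ->
  let w h := fun y => u y + h * (sg * bump x y) in
  coupling (cexp a) (cexp b) (w h) v @[h --> 0^'+] -->
    coupling (cexp a) (cexp b) u v ->
  (forall e, 0 < e -> \forall h \near 0^'+,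
    coupling (cexp a) (cexp b) u v + h * (k - e) <=
    coupling (cexp a) (cexp b) (w h) v) ->
  0 <= sg * pounds_form G Omega (ord a) (expo a) u (bump x)
       - sg * (lam a * pot a x * (`|u x| `^ (gam a - 2) * u x) * mu G x)
       - k / s.
Proof.
move=> cs oka okb [[uC vC] n0 e0 emin] Ox w Kcvg Kge.
have [[ga1 gaa gab as_] [ca la ha]] := oka.
have [[gb1 gbb gba bs_] [cb lb hb]] := okb.
have w0 : w 0 = u by apply/funext => y; rewrite /w mul0r addr0.
pose A h := dirichlet G Omega (ord a) (expo a) (w h).
pose H h := - (lam a * power_integral (pot a) (gam a) (w h)).
pose K h := - coupling (cexp a) (cexp b) (w h) v.
pose dA := expo a * pounds_form G Omega (ord a) (expo a) u
  (fun y => sg * bump x y).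
pose dH := - lam a * (mu G x * pot a x *
  (gam a * (`|u x| `^ (gam a - 2) * u x) * sg)).
have AD : is_derive (0 : R) 1 A dA by apply: is_derive_dirichlet => //; lra.
have HD : is_derive (0 : R) 1 H dH.
  have -> : H = (- lam a) \*: (fun h => power_integral (pot a) (gam a) u -
      pot a x * `|u x| `^ gam a * mu G x +
      mu G x * pot a x * `|u x + h * sg| `^ gam a).
    by apply/funext => h; rewrite /H power_integral_bump// -mulNr.
  by apply: is_deriveZ; apply: is_derive_line_powR; rewrite ga1.
pose L : seq ((R -> R) * R * R) :=
  [:: (A, dA, expo a);
      (fun=> dirichlet G Omega (ord b) (expo b) v, 0, expo b);
      (H, dH, gam a);
      (fun=> - (lam b * power_integral (pot b) (gam b) v), 0, gam b);
      (K, - k, s)].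
have LE h : gpoly_at L h = terms a b (w h) v by [].
have cstD (y : R) : is_derive (0 : R) 1 (fun=> y) (0 : R).
  exact: is_derive_cst.
have H1 : forall i, i \in L -> 0 < i.2.
  move=> i iL; have : (i.1.1 0, i.2) \in gpoly_at L 0 by exact: map_f iL.
  by rewrite LE => /(terms_exponent_gt0 oka okb).
have H2 : forall i, i \in L -> i.1.1 h @[h --> 0^'+] --> i.1.1 0.
  move=> i; rewrite !inE => /or4P[|||/orP[]] /eqP ->/=.
  - exact: is_derive_right_cvg AD.
  - exact: cvg_cst.
  - exact: is_derive_right_cvg HD.
  - exact: cvg_cst.
  - by rewrite /K w0; exact: cvgN.
have H3 : forall i, i \in L -> forall e, 0 < e ->
    \forall h \near 0^'+, i.1.1 h <= i.1.1 0 + h * (i.1.2 + e).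
  move=> i; rewrite !inE => /or4P[|||/orP[]] /eqP ->/= e egt0.
  - exact: is_derive_right_le AD egt0.
  - exact: is_derive_right_le (cstD _) egt0.
  - exact: is_derive_right_le HD egt0.
  - exact: is_derive_right_le (cstD _) egt0.
  - near=> h; rewrite /K w0.
    have : coupling (cexp a) (cexp b) u v + h * (k - e) <=
      coupling (cexp a) (cexp b) (w h) v by near: h; exact: Kge.
    rewrite (_ : h * (- k + e) = - (h * (k - e))); last by ring.
    lra.
(* By homogeneity a critical point [t] on the ray of [(w h, v)] is a point of the Nehari set, with
   which the minimizer can be compared. *)
have H4 : forall h t, 0 < h -> 0 < t -> gpoly (gpoly_at L h) t = 0 ->
    0 < gpoly (gprim (gpoly_at L h)) t ->
    system_energy a b u v <= gpoly (gprim (gpoly_at L h)) t.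
  move=> h t _ t0; have tn0 : t != 0 by rewrite gt_eqF.
  rewrite LE -nehari_scale// -system_energy_scale//; apply: emin.
    by move=> y Oy; rewrite /w (Cc_add _ _ Ox uC)// mulr0.
  by move=> y Oy; rewrite vC// mulr0.
have signs : forall i, i \in gpoly_at L 0 ->
    i.1 * (i.2 - Num.max (expo a) (expo b)) *
    (i.2 - Num.min (expo a) (expo b)) <= 0.
  by rewrite LE w0; exact: terms_signs.
have := @gprim_peak_perturbation _ L _ _ H1 signs.
rewrite LE w0 => /(_ n0 e0 H2 H3 H4); rewrite !big_cons big_nil/= !mul0r !add0r
    addr0.
have -> : dA / expo a = sg * pounds_form G Omega (ord a) (expo a) u (bump x).
  rewrite /dA mulrAC divff ?mul1r; last by rewrite gt_eqF//; lra.
  exact: pounds_formZ.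
have -> : dH / gam a =
    - (sg * (lam a * pot a x * (`|u x| `^ (gam a - 2) * u x) * mu G x)).
  by rewrite /dH; field; rewrite gt_eqF//; lra.
by rewrite mulNr !addrA.
Unshelve. all: by end_near. Qed.

End System.

(** * Euler-Lagrange equations at a minimizer *)

Section EulerLagrange.
Context {R : realType} {V : choiceType}.
Variables (G : wgraph R V) (Omega : set V).
Hypothesis hG : locally_finite G.
Hypothesis Ofin : finite_set (clos G Omega).
Variables (s : R) (c : V -> R).
Hypothesis c_gt0 : forall x, Omega x -> 0 < c x.
Implicit Types (a b : side R V) (u v : V -> R) (x : V).

Lemma Cc_bump_sum u y : Cc Omega u ->
  \sum_(x <- fset_set Omega) u x * bump x y = u y.
Proof.
have Ofin' := finite_Omega Ofin; move=> uC.
have [Oy|nOy] := pselect (Omega y).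
  rewrite (bigD1_seq y)/= ?fset_uniq//; last by rewrite in_fset_set //; exact:
      mem_set.
  rewrite /bump eqxx mulr1 big1 ?addr0// => x; rewrite eq_sym => /negbTE ->.
  by rewrite mulr0.
rewrite uC// big_seq big1// => x; rewrite in_fset_set// => /set_mem Ox.
by rewrite /bump; case: eqP => [yx|_]; [rewrite yx in nOy|rewrite mulr0].
Qed.

(** The form is linear in the test function, and the bumps at vertices of [Omega] span
    [Cc Omega]. *)
Lemma is_pounds_bump m p u (L : V -> R) :
  (forall x, Omega x -> pounds_form G Omega m p u (bump x) = L x * mu G x) ->
  is_pounds G Omega m p u L.
Proof.
move=> Lx phi phiC; rewrite integral_onE; last exact: finite_Omega Ofin.
rewrite [in RHS](_ : phi = fun y =>
    \sum_(x <- fset_set Omega) phi x * bump x y); last first.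
  by apply/funext => y; rewrite Cc_bump_sum.
have : forall x, x \in (fset_set Omega : seq V) -> Omega x.
  by move=> x; rewrite in_fset_set => [/set_mem|]; last exact: finite_Omega
      Ofin.
elim: (fset_set Omega : seq V) => [_|x r IHr rO].
  rewrite big_nil (_ : (fun y => _) = (fun y => 0 * (fun=> 0 : R) y)).
    by rewrite pounds_formZ// mul0r.
  by apply/funext => y; rewrite big_nil mul0r.
rewrite big_cons IHr; last by move=> y yr; apply: rO; rewrite inE yr orbT.
rewrite [in RHS](_ : (fun y => _) = (fun y => phi x * bump x y +
    (fun y => \sum_(x <- r) phi x * bump x y) y)); last first.
  by apply/funext => y; rewrite big_cons.
rewrite pounds_form_linear// Lx; last by apply: rO; rewrite mem_head.
by congr (_ + _); ring.
Qed.

Lemma norm_ge_powR_small (t a : R) : 0 < t < 1 -> a <= 1 -> t <= t `^ a.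
Proof. by move=> /andP[t0 t1] a1; rewrite ger1_powR// t0 ltW. Qed.

(* Where the coupling term is not differentiable in [u x], namely
   [cexp a <= 1], [u x = 0] and [v x != 0], it grows at least linearly in both
   directions, which a minimizer does not allow. *)
Lemma nehari_minimizer_equation a b u v x :
  cexp a + cexp b = s -> side_ok Omega s a b -> side_ok Omega s b a ->
  nehari_minimizer G Omega s c a b u v -> Omega x ->
  pounds_form G Omega (ord a) (expo a) u (bump x) =
  (lam a * pot a x * (`|u x| `^ (gam a - 2) * u x) +
   cexp a / s * c x * (`|u x| `^ (cexp a - 2) * u x) * `|v x| `^ cexp b) *
  mu G x.
Proof.
move=> cs oka okb uvmin Ox.
have [_ [ca la ha]] := oka; have [_ [cb lb hb]] := okb.
have s0 : 0 < s by rewrite -cs addr_gt0.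
have dir sg k := nehari_minimizer_direction (sg := sg) (k := k) hG Ofin c_gt0 cs
  oka okb uvmin Ox.
set w := fun sg h y => u y + h * (sg * bump x y) in dir.
have w0 sg : w sg 0 = u by apply/funext => y; rewrite /w mul0r addr0.
pose Kd := mu G x * c x * `|v x| `^ cexp b *
  (cexp a * (`|u x| `^ (cexp a - 2) * u x)).
pose K sg h := coupling G Omega c (cexp a) (cexp b) (w sg h) v.
have KE sg : K sg = fun h => coupling G Omega c (cexp a) (cexp b) u v -
    c x * `|u x| `^ cexp a * `|v x| `^ cexp b * mu G x +
    mu G x * c x * `|v x| `^ cexp b * `|u x + h * sg| `^ cexp a.
  by apply/funext => h; rewrite /K coupling_bump.
have smooth : (forall sg, is_derive (0 : R) 1 (K sg) (Kd * sg)) ->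
    pounds_form G Omega (ord a) (expo a) u (bump x) =
    lam a * pot a x * (`|u x| `^ (gam a - 2) * u x) * mu G x + Kd / s.
  move=> KD; have D sg : 0 <= sg * pounds_form G Omega (ord a) (expo a) u (bump
      x) -
      sg * (lam a * pot a x * (`|u x| `^ (gam a - 2) * u x) * mu G x) -
      Kd * sg / s.
    apply: dir => [|e e0].
      by have := is_derive_right_cvg (KD sg); rewrite /K w0; exact.
    by have := is_derive_right_ge (KD sg) e0; rewrite /K w0; exact.
  have := D 1; have := D (-1).
  rewrite mulr1 mulrN1 !mul1r !mulN1r mulNr opprK.
  by move=> D1 D2; apply/eqP; rewrite eq_le; apply/andP; split; lra.
(* Where [v x = 0] the coupling does not depend on the value of [u] at [x], so its derivative is 0
   whatever the exponent [cexp a]. *)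
have [vx0|vx0] := eqVneq (v x) 0.
  have v0 : `|v x| `^ cexp b = 0 by rewrite vx0 normr0 powR0 ?gt_eqF.
  have KD sg : is_derive (0 : R) 1 (K sg) (Kd * sg).
    rewrite KE /Kd v0 !(mulr0, mul0r, subr0).
    rewrite (_ : (fun h => _) =
        cst (coupling G Omega c (cexp a) (cexp b) u v)).
      exact: is_derive_cst.
    by apply/funext => h; rewrite mul0r addr0.
  by rewrite (smooth KD) /Kd v0 !(mulr0, mul0r, addr0).
have vpos : 0 < `|v x| `^ cexp b by rewrite powR_gt0// normr_gt0.
have cmu : 0 < mu G x * c x * `|v x| `^ cexp b.
  by rewrite !mulr_gt0 ?mu_gt0 ?c_gt0.
have [aux|] := boolP ((1 < cexp a) || (u x != 0)).
  have KD sg : is_derive (0 : R) 1 (K sg) (Kd * sg).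
    by rewrite KE /Kd -(mulrA _ _ sg); exact: is_derive_line_powR.
  by rewrite (smooth KD) /Kd; field; rewrite gt_eqF.
rewrite negb_or -leNgt negbK => /andP[ca1 /eqP ux0].
pose k := mu G x * c x * `|v x| `^ cexp b.
have D sg : `|sg| = 1 -> 0 <= sg * pounds_form G Omega (ord a) (expo a) u (bump
    x) -
      sg * (lam a * pot a x * (`|u x| `^ (gam a - 2) * u x) * mu G x) - k / s.
  move=> sg1.
  have KE' : K sg = fun h => coupling G Omega c (cexp a) (cexp b) u v +
      k * `|h| `^ cexp a.
    rewrite KE; apply/funext => h; rewrite ux0 add0r normr0 powR0 ?gt_eqF//.
    by rewrite !(mulr0, mul0r) subr0 normrM sg1 mulr1.
  apply: dir => [|e e0].
    rewrite -[X in X @ _]/(K sg) KE' -[X in _ --> X]addr0.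
    apply: cvgD; first exact: cvg_cst.
    rewrite -[X in _ --> X](mulr0 k); apply: cvgM; first exact: cvg_cst.
    have := continuous_norm_powR ca (x := 0).
    rewrite /continuous_at normr0 powR0 ?gt_eqF//.
    exact: cvg_at_right_filter.
  near=> h; rewrite -[leRHS]/(K sg h) KE'.
  have h0 : 0 < h by near: h; exact: nbhs_right_gt.
  have h1 : h < 1 by near: h; exact: nbhs_right_lt.
  rewrite lerD2l gtr0_norm//; apply: (@le_trans _ _ (h * k)).
    by rewrite ler_wpM2l ?ltW// gtrBl.
  rewrite mulrC; apply: ler_wpM2l; first exact: ltW.
  by apply: norm_ge_powR_small; rewrite ?h0.
(* The inequalities in the two directions add up to [0 <= - 2 * (k / s)], against [k > 0]. *)
have := D 1 (normr1 _); have := D (-1); rewrite normrN1 => /(_ erefl).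
have : 0 < k / s by exact: divr_gt0.
rewrite !mul1r !mulN1r; lra.
Unshelve. all: by end_near. Qed.

End EulerLagrange.

(** * Existence of minimizers *)

Section Existence.
Context {R : realType} {V : choiceType}.
Variables (G : wgraph R V) (Omega : set V).
Hypothesis hG : locally_finite G.
Hypothesis Ofin : finite_set (clos G Omega).
Hypothesis O0 : Omega !=set0.
Implicit Types (a b : side R V) (u v : V -> R) (x : V).

Let T := prod_topology (fun _ : V => (R : topologicalType)).

Definition sup_embedding a := exists2 C, 0 <= C & forall u, Cc Omega u ->
  forall x, `|u x| <= C * W0norm G Omega (ord a) (expo a) u.

(** The sup bound places the sublevel set in a product of segments over [Omega], with the factor
    [{0}] elsewhere to encode [Cc Omega]; inside this compact box it is cut out by a closed
    condition. *)
Lemma compact_dirichlet_sublevel a B : sup_embedding a -> 0 < expo a ->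
  compact [set u : T | Cc Omega u /\ dirichlet G Omega (ord a) (expo a) u <= B].
Proof.
move=> [C C0 Cu] p0; pose r := C * B `^ (expo a)^-1.
pose box x : set R := if x \in Omega then `[- r, r]%classic else [set 0].
have boxc : compact [set u : T | forall x, box x (u x)].
  apply: (@tychonoff V (fun=> R)) => x; rewrite /box; case: ifP => _.
    exact: segment_compact.
  exact: compact_set1.
rewrite (_ : [set u | _] = [set u : T | forall x, box x (u x)] `&`
    [set u : T | dirichlet G Omega (ord a) (expo a) u <= B]).
  apply: compact_closedI boxc _.
  apply: (@closed_comp T R (fun u : T => dirichlet G Omega (ord a) (expo a) u)
    [set y | y <= B]); last exact: closed_le.
  by move=> u _; exact: continuous_dirichlet.
apply/seteqP; split => u /=.
  move=> [uC uB]; split=> // x; rewrite /box; case: ifPn => [_|/negP xO].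
    rewrite /= in_itv/= -ler_norml; apply: le_trans (Cu _ uC x) _.
    have u0 := dirichlet_ge0 G Omega (ord a) (expo a) u.
    apply: ler_wpM2l => //; apply: ge0_ler_powR => //.
    - by rewrite invr_ge0 ltW.
    - by rewrite nnegrE (le_trans u0).
  by rewrite /= uC// => Ox; apply: xO; exact: mem_set.
move=> [ubox uB]; split=> // x Ox; have := ubox x; rewrite /box.
by case: ifPn => // /set_mem.
Qed.

Lemma power_integral_le a (h : V -> R) g : sup_embedding a -> 0 <= g ->
  (forall x, Omega x -> 0 < h x) -> exists2 C, 0 <= C & forall u, Cc Omega u ->
  power_integral G Omega h g u <= C * W0norm G Omega (ord a) (expo a) u `^ g.
Proof.
move=> [C C0 Cu] g0 h0; exists (C `^ g * integral_on G Omega h).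
  by rewrite mulr_ge0 ?powR_ge0// integral_on_ge0// => x /h0/ltW.
move=> u uC; rewrite mulrAC -powRM ?powR_ge0// -integral_onZ.
apply: le_integral_on => [|x Ox]; first exact: finite_Omega Ofin.
rewrite mulrC; apply: ler_wpM2r; first exact/ltW/h0.
by apply: ge0_ler_powR; rewrite ?nnegrE ?mulr_ge0 ?powR_ge0 ?Cu.
Qed.

(** Since [gam a < expo a], the concave term costs an arbitrarily small share of the Dirichlet term,
    up to a constant. Both coercivity arguments rest on this. *)
Lemma power_integral_absorb a (k1 k2 : R) : sup_embedding a ->
  0 < gam a -> gam a < expo a -> (forall x, Omega x -> 0 < pot a x) ->
  0 < k1 -> 0 <= k2 -> exists2 B, 0 <= B & forall u, Cc Omega u ->
  k2 * power_integral G Omega (pot a) (gam a) u <=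
  k1 * dirichlet G Omega (ord a) (expo a) u + B.
Proof.
move=> emb g0 gp h0 k10 k20.
have [C C0 Cu] := power_integral_le emb (ltW g0) h0.
have [B B0 Bt] := powR_abs_bound g0 gp k10 (mulr_ge0 k20 C0).
exists B => // u uC; rewrite dirichletE ?gt_eqF ?(lt_trans g0)//.
by apply: le_trans (Bt _ (powR_ge0 _ _)); rewrite -mulrA ler_wpM2l// Cu.
Qed.

Lemma dirichlet0 m p : p != 0 -> dirichlet G Omega m p (fun=> 0) = 0.
Proof.
move=> p0; rewrite /dirichlet /integral_on fsbig1// => x _.
by rewrite gradm_cst0 powR0// mul0r.
Qed.

Lemma power_integral0 h g : g != 0 -> power_integral G Omega h g (fun=> 0) = 0.
Proof.
move=> g0; rewrite /power_integral /integral_on fsbig1// => x _.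
by rewrite normr0 powR0// mulr0 mul0r.
Qed.

Lemma Cc0 : Cc Omega (fun=> 0 : R). Proof. by []. Qed.

Lemma Cc_bump x : Omega x -> Cc Omega (bump x : V -> R).
Proof. by move=> Ox y Oy; rewrite /bump; case: eqP => // yx; rewrite yx in Oy.
    Qed.

Lemma CcZ t u : Cc Omega u -> Cc Omega (fun y => t * u y).
Proof. by move=> uC y Oy; rewrite uC// mulr0. Qed.

Lemma power_integral_bump_gt0 h g x : (forall x, Omega x -> 0 < h x) ->
  Omega x -> 0 < power_integral G Omega h g (bump x).
Proof.
move=> h0 Ox; rewrite /power_integral.
apply: (@integral_on_gt0 _ _ G _ _ x) => // [|y Oy|]; first exact: finite_Omega
    Ofin.
  by rewrite mulr_ge0 ?powR_ge0// ltW ?h0.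
by rewrite /bump eqxx normr1 powR1 mulr1 h0.
Qed.

Definition scalar_energy a u : R :=
  dirichlet G Omega (ord a) (expo a) u / expo a -
  lam a / gam a * power_integral G Omega (pot a) (gam a) u.

Lemma continuous_power_integral h g : 0 < g ->
  continuous (fun u : T => power_integral G Omega h g u).
Proof.
move=> g0; rewrite (_ : (fun u => _) = (fun u : T =>
    \sum_(x <- fset_set Omega) h x * `|u x| `^ g * mu G x)); last first.
  by apply/funext => u; apply: integral_onE; exact: finite_Omega Ofin.
apply: continuous_bigsum => x _ u.
apply: (@continuousM _ T _ (cst _)); last exact: cst_continuous.
apply: (@continuousM _ T (cst _)); first exact: cst_continuous.
apply: (@continuous_comp _ _ _ (fun u : T => u x) (fun t : R => `|t| `^ g)).
  exact: proj_continuous.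
exact: continuous_norm_powR.
Qed.

Lemma scalar_minimizer a : sup_embedding a -> 1 < gam a -> gam a < expo a ->
  0 < lam a -> (forall x, Omega x -> 0 < pot a x) ->
  exists u, [/\ Cc Omega u, scalar_energy a u < 0
    & forall w, Cc Omega w -> scalar_energy a u <= scalar_energy a w].
Proof.
move=> emb g1 gp l0 h0.
have g0 : 0 < gam a by lra.
have p0 : 0 < expo a by lra.
have lg0 : 0 < lam a / gam a by exact: divr_gt0.
have k0 : 0 < (2 * expo a)^-1 by rewrite invr_gt0 mulr_gt0.
have [B B0 Bu] := power_integral_absorb emb g0 gp h0 k0 (ltW lg0).
pose D u := dirichlet G Omega (ord a) (expo a) u.
have E0 : scalar_energy a (fun=> 0) = 0.
  by rewrite /scalar_energy dirichlet0 ?power_integral0 ?gt_eqF// mul0r mulr0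
      subr0.
(* The concave term was absorbed by half of the Dirichlet term, so outside this set the energy is
   positive, whereas 0 lies inside and has energy 0. *)
pose S := [set u : T | Cc Omega u /\ D u <= 2 * expo a * B].
have S0 : S (fun=> 0).
  split; first exact: Cc0.
  by rewrite /D dirichlet0 ?gt_eqF// !mulr_ge0// ltW.
have Ec : continuous (fun u : T => scalar_energy a u).
  move=> u; apply: (@continuousB _ R T).
    apply: (@continuousM _ T _ (cst _)); last exact: cst_continuous.
    exact: continuous_dirichlet.
  apply: (@continuousM _ T (cst _)); first exact: cst_continuous.
  exact: continuous_power_integral.
have Sn0 : S !=set0 by exists (fun=> 0).
have Sc : compact S by exact: compact_dirichlet_sublevel.
have [u /set_mem[uC _] umin] :=
  compact_EVT_min Sn0 Sc (continuous_subspaceT Ec).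
have gmin w : Cc Omega w -> scalar_energy a u <= scalar_energy a w.
  move=> wC; have [wB|wB] := leP (D w) (2 * expo a * B).
    by apply: umin; exact: mem_set.
  apply: (@le_trans _ _ 0); first by rewrite -E0; apply: umin; exact: mem_set.
  have := Bu w wC; rewrite /scalar_energy -/(D w) invfM => HB.
  have : B < D w / expo a / 2.
    by rewrite !ltr_pdivlMr//; apply: le_lt_trans wB; rewrite le_eqVlt;
        apply/orP; left; apply/eqP; ring.
  have : 2^-1 / expo a * D w = D w / expo a / 2 by ring.
  lra.
exists u; split => //.
have [x Ox] := O0; have wC := Cc_bump Ox.
have H0 := power_integral_bump_gt0 (gam a) h0 Ox.
pose A := D (bump x) / expo a.
pose H := lam a / gam a * power_integral G Omega (pot a) (gam a) (bump x).
have A0 : 0 <= A by rewrite divr_ge0 ?dirichlet_ge0// ltW.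
have HH0 : 0 < H by rewrite mulr_gt0.
have pg : 0 < expo a - gam a by rewrite subr_gt0.
(* Chosen so that [t ^ (expo a - gam a) = H / (A + 1)]: the operator part is then [A * H / (A + 1)]
   times [t ^ gam a], strictly below the concave part [H * t ^ gam a]. *)
pose t := (H / (A + 1)) `^ (expo a - gam a)^-1.
have A1 : 0 < A + 1 by rewrite ltr_wpDl.
have t0 : 0 < t by rewrite powR_gt0// divr_gt0.
apply: le_lt_trans (gmin _ (CcZ t wC)) _.
rewrite /scalar_energy dirichlet_scale// power_integral_scale gtr0_norm//.
rewrite -mulrA -/(D _) -/A [X in _ - X]mulrCA -/H subr_lt0.
rewrite (_ : t `^ expo a = t `^ gam a * t `^ (expo a - gam a)); last first.
  by rewrite -powRD ?subrKC// (gt_eqF t0) implybT.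
rewrite -[X in X < _]mulrA (ltr_pM2l (powR_gt0 _ t0)) /t -powRrM mulVf
    ?gt_eqF// powRr1.
  by rewrite mulrAC ltr_pdivrMr// ltr_pM2l// ltrDl.
by rewrite divr_ge0 ?ltW.
Qed.

Lemma is_derive_global_min_ge0 (f : R -> R) d : is_derive (0 : R) 1 f d ->
  (forall h, f 0 <= f h) -> 0 <= d.
Proof.
move=> fd fmin; rewrite leNgt; apply/negP => d0.
have e0 : 0 < - d / 2 by lra.
apply: (@filter_not_empty _ ((0 : R)^'+)); near=> h.
have h0 : 0 < h by near: h; exact: nbhs_right_gt.
have : f h <= f 0 + h * (d + - d / 2).
  by near: h; exact: is_derive_right_le fd e0.
have : h * (d + - d / 2) < 0 by rewrite pmulr_rlt0//; lra.
by have := fmin h; lra.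
Unshelve. all: by end_near. Qed.

Lemma scalar_minimizer_equation a u x : 1 < gam a -> 1 < expo a -> Cc Omega u ->
  (forall w, Cc Omega w -> scalar_energy a u <= scalar_energy a w) ->
  Omega x -> pounds_form G Omega (ord a) (expo a) u (bump x) =
  lam a * pot a x * (`|u x| `^ (gam a - 2) * u x) * mu G x.
Proof.
move=> g1 p1 uC umin Ox.
have D sg : 0 <= sg * pounds_form G Omega (ord a) (expo a) u (bump x) -
    sg * (lam a * pot a x * (`|u x| `^ (gam a - 2) * u x) * mu G x).
  pose w h : V -> R := fun y => u y + h * (sg * bump x y).
  have w0 : w 0 = u by apply/funext => y; rewrite /w mul0r addr0.
  apply: (@is_derive_global_min_ge0 (fun h => scalar_energy a (w h))); last
      first.
    by move=> h; rewrite w0; apply: umin; exact: Cc_add.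
  have AD := is_derive_dirichlet hG (ord a) u (fun y => sg * bump x y) Ofin p1.
  have HD : is_derive (0 : R) 1
      (fun h => power_integral G Omega (pot a) (gam a) (w h))
      (mu G x * pot a x * (gam a * (`|u x| `^ (gam a - 2) * u x) * sg)).
    rewrite (_ : (fun h => _) = fun h => power_integral G Omega (pot a) (gam a)
        u -
      pot a x * `|u x| `^ gam a * mu G x +
      mu G x * pot a x * `|u x + h * sg| `^ gam a).
      by apply: is_derive_line_powR; rewrite g1.
    by apply/funext => h; rewrite power_integral_bump.
  rewrite (_ : (fun h => scalar_energy a (w h)) =
      (expo a)^-1 \*: (fun h => dirichlet G Omega (ord a) (expo a) (w h)) -
      lam a / gam a \*: (fun h => power_integral G Omega (pot a) (gam a) (w
          h)));
    last by apply/funext => h; rewrite /scalar_energy mulrC.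
  have := is_deriveB (is_deriveZ (expo a)^-1 AD)
    (is_deriveZ (lam a / gam a) HD).
  move=> H; apply: (@is_derive_eq _ _ _ _ _ _ _ _ H); rewrite pounds_formZ//.
  rewrite -[X in X - _]/(_ * _) -[X in _ - X]/(_ * _).
  by field; rewrite !gt_eqF//; lra.
have := D 1; have := D (-1); rewrite !mul1r !mulN1r => D1 D2.
by apply/eqP; rewrite eq_le; apply/andP; split; lra.
Qed.

End Existence.

(** * Minimization over the Nehari points of positive energy *)

Section NehariMinimizer.
Context {R : realType} {V : choiceType}.
Variables (G : wgraph R V) (Omega : set V).
Hypothesis hG : locally_finite G.
Hypothesis Ofin : finite_set (clos G Omega).
Hypothesis O0 : Omega !=set0.
Variables (s : R) (c : V -> R) (a b : side R V).
Hypothesis c_gt0 : forall x, Omega x -> 0 < c x.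
Hypotheses (cs : cexp a + cexp b = s).
Hypotheses (oka : side_ok Omega s a b) (okb : side_ok Omega s b a).
Hypotheses (emba : sup_embedding G Omega a) (embb : sup_embedding G Omega b).
Variables (r rho : R).
Hypotheses (r0 : 0 < r) (rho0 : 0 < rho).
Notation Na := (W0norm G Omega (ord a) (expo a)).
Notation Nb := (W0norm G Omega (ord b) (expo b)).
Notation energy := (system_energy G Omega s c a b).
Notation neh := (nehari G Omega s c a b).
Hypothesis ridge : forall u v, Cc Omega u -> Cc Omega v ->
  Na u + Nb v = r -> rho <= energy u v.
Implicit Types (u v : V -> R) (x : V).

Let T := prod_topology (fun _ : V => (R : topologicalType)).

Let s0 : 0 < s.
Proof. by move: oka => -[[? ? ? ?] _]; lra. Qed.

Let pa0 : 0 < expo a.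
Proof. by move: oka => -[[? ? ? ?] _]; lra. Qed.

Let pb0 : 0 < expo b.
Proof. by move: okb => -[[? ? ? ?] _]; lra. Qed.

Lemma energyE u v : energy u v =
  dirichlet G Omega (ord a) (expo a) u / expo a +
  dirichlet G Omega (ord b) (expo b) v / expo b -
  lam a / gam a * power_integral G Omega (pot a) (gam a) u -
  lam b / gam b * power_integral G Omega (pot b) (gam b) v -
  s^-1 * coupling G Omega c (cexp a) (cexp b) u v.
Proof. by rewrite /system_energy gprim_terms normr1 !powR1; ring. Qed.

Lemma nehE u v : neh u v =
  dirichlet G Omega (ord a) (expo a) u + dirichlet G Omega (ord b) (expo b) v -
  lam a * power_integral G Omega (pot a) (gam a) u -
  lam b * power_integral G Omega (pot b) (gam b) v -
  1 * coupling G Omega c (cexp a) (cexp b) u v.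
Proof. by rewrite /nehari gpoly_terms normr1 !powR1; ring. Qed.

Lemma W0norm_sum_scale t u v :
  Na (fun y => t * u y) + Nb (fun y => t * v y) = `|t| * (Na u + Nb v).
Proof. by rewrite !W0norm_scale ?gt_eqF// mulrDr. Qed.

Lemma ridge_scale u v : Cc Omega u -> Cc Omega v -> 0 < Na u + Nb v ->
  rho <= gpoly (gprim (terms G Omega s c a b u v)) (r / (Na u + Nb v)).
Proof.
move=> uC vC N0; have t0 : 0 < r / (Na u + Nb v) by exact: divr_gt0.
rewrite -(system_energy_scale _ hG _ _ _ cs (lt0r_neq0 t0)).
apply: ridge; [exact: CcZ|exact: CcZ|rewrite W0norm_sum_scale].
by rewrite gtr0_norm// divfK// gt_eqF.
Qed.

(** If both norms vanished, only the subtracted nonnegative terms of the energy would remain. *)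
Lemma W0norm_sum_gt0 u v : 0 < energy u v -> 0 < Na u + Nb v.
Proof.
move=> e0; rewrite lt_neqAle addr_ge0 ?powR_ge0// andbT; apply/eqP => /esym/eqP.
rewrite paddr_eq0 ?powR_ge0// => /andP[/eqP Nu /eqP Nv].
have [_ [_ la ha]] := oka; have [_ [_ lb hb]] := okb.
have [[ga1 _ _ _] _] := oka; have [[gb1 _ _ _] _] := okb.
have ga0 : 0 < gam a := lt_trans ltr01 ga1.
have gb0 : 0 < gam b := lt_trans ltr01 gb1.
move: e0; rewrite energyE !dirichletE ?gt_eqF// Nu Nv !powR0 ?gt_eqF//.
rewrite !mul0r add0r sub0r.
have : 0 <= lam a / gam a * power_integral G Omega (pot a) (gam a) u.
  by apply: mulr_ge0; [exact/ltW/divr_gt0|exact: power_integral_ge0].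
have : 0 <= lam b / gam b * power_integral G Omega (pot b) (gam b) v.
  by apply: mulr_ge0; [exact/ltW/divr_gt0|exact: power_integral_ge0].
have : 0 <= s^-1 * coupling G Omega c (cexp a) (cexp b) u v.
  by apply: mulr_ge0; [rewrite invr_ge0 ltW|exact: coupling_ge0].
by move=> HK HJ HI; rewrite -!opprD oppr_gt0 ltNge !addr_ge0.
Qed.

(** The ray meets the sphere at parameter [r / (Na u + Nb v)], where the energy is at least [rho],
    and by [gprim_peak] the value at parameter 1 dominates it. *)
Lemma nehari_energy_ge u v : Cc Omega u -> Cc Omega v -> neh u v = 0 ->
  0 < energy u v -> rho <= energy u v.
Proof.
move=> uC vC n0 e0; have N0 := W0norm_sum_gt0 e0.
apply: le_trans (ridge_scale uC vC N0) _.
have [peak _ _] := gprim_peak (terms_exponent_gt0 oka okb)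
  (terms_signs c_gt0 oka okb) n0 e0.
by apply: peak; exact: divr_gt0.
Qed.

(** Taking the same bump in both components makes the coupling positive, so the energy on this ray
    is at least [rho] on the sphere and negative far out; its maximum in between is a critical
    point. *)
Lemma nehari_nonempty : exists u v,
  [/\ Cc Omega u, Cc Omega v, neh u v = 0 & 0 < energy u v].
Proof.
have [x Ox] := O0; have uC := Cc_bump (R := R) Ox; pose w : V -> R := bump x.
have [_ [ca la ha]] := oka; have [_ [cb lb hb]] := okb.
have [[ga1 gaa gab as_] _] := oka; have [[gb1 gbb gba bs_] _] := okb.
pose f := gpoly (gprim (terms G Omega s c a b w w)).
have lpos := @terms_exponent_gt0 _ _ G _ _ c _ _ w w oka okb.
pose K := coupling G Omega c (cexp a) (cexp b) w w.
have K0 : 0 < K.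
  rewrite /K /coupling.
  apply: (@integral_on_gt0 _ _ G _ _ x) => // [|y Oy|]; first exact:
      finite_Omega Ofin.
    by rewrite !mulr_ge0 ?powR_ge0// ltW ?c_gt0.
  by rewrite /w /bump eqxx normr1 !powR1 !mulr1 c_gt0.
pose A := dirichlet G Omega (ord a) (expo a) w.
pose B := dirichlet G Omega (ord b) (expo b) w.
(* Each operator term is absorbed by a quarter of the coupling term [K / s], which leaves the other
   half to drive the energy down. *)
have k0 : 0 < K / (4 * s) by rewrite divr_gt0// mulr_gt0.
have A0 : 0 <= A / expo a by rewrite divr_ge0 ?dirichlet_ge0// ltW.
have B0 : 0 <= B / expo b by rewrite divr_ge0 ?dirichlet_ge0// ltW.
have [C1 C10 C1t] := powR_abs_bound pa0 as_ k0 A0.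
have [C2 C20 C2t] := powR_abs_bound pb0 bs_ k0 B0.
have fle t : 0 <= t -> f t <= C1 + C2 - K / (2 * s) * t `^ s.
  move=> t0; rewrite /f gprim_terms -/A -/B -/K ger0_norm//.
  have := C1t t t0; have := C2t t t0.
  have : 0 <= lam a * power_integral G Omega (pot a) (gam a) w / gam a * t `^
      gam a.
    rewrite mulr_ge0 ?powR_ge0// divr_ge0//; last by lra.
    by rewrite mulr_ge0 ?power_integral_ge0// ltW.
  have : 0 <= lam b * power_integral G Omega (pot b) (gam b) w / gam b * t `^
      gam b.
    rewrite mulr_ge0 ?powR_ge0// divr_ge0//; last by lra.
    by rewrite mulr_ge0 ?power_integral_ge0// ltW.
  have -> : K / (4 * s) = K / s / 4 by field; rewrite gt_eqF.
  have -> : K / (2 * s) = K / s / 2 by field; rewrite gt_eqF.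
  rewrite -!(mulrA (K / s)) !(mulrCA (K / s)).
  set X := K / s * t `^ s.
  lra.
(* Solves [K / (2 * s) * t2 ^ s = C1 + C2 + 1]; the extra 1 makes the bound [fle] strictly negative
   from there on. *)
pose t2 := ((C1 + C2 + 1) / (K / (2 * s))) `^ s^-1.
have K20 : 0 < K / (2 * s) by rewrite divr_gt0// mulr_gt0.
have C0 : 0 < C1 + C2 + 1 by lra.
have t20 : 0 < t2 by rewrite powR_gt0// divr_gt0.
have fneg t : t2 <= t -> f t < 0.
  move=> tt2; have t0 := lt_le_trans t20 tt2.
  apply: le_lt_trans (fle _ (ltW t0)) _; rewrite subr_lt0.
  apply: (@lt_le_trans _ _ (K / (2 * s) * t2 `^ s)); last first.
    apply: ler_wpM2l; first exact: ltW.
    by apply: ge0_ler_powR; rewrite ?nnegrE ?(ltW t20) ?(ltW t0) ?(ltW s0).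
  rewrite /t2 -powRrM mulVf ?gt_eqF// powRr1; last by rewrite ltW// divr_gt0.
  by rewrite mulrCA divff ?gt_eqF// mulr1; lra.
have N0 : 0 < Na w + Nb w.
  have [C _ Cw] := emba; rewrite ltr_pwDl ?powR_ge0// lt_neqAle powR_ge0 andbT.
  apply/eqP => Nw; have := Cw _ uC x.
  by rewrite -Nw mulr0 /bump eqxx normr1 ler10.
pose t1 := r / (Na w + Nb w).
have t10 : 0 < t1 by exact: divr_gt0.
have ft1 : 0 < f t1 by apply: lt_le_trans (ridge_scale uC uC N0).
have t12 : t1 < t2 by rewrite ltNge; apply/negP => /fneg; rewrite ltNge ltW.
have fc : {within `[0, t2], continuous f}.
  by apply: continuous_subspaceT; apply/continuous_gpoly/gprim_exponent_gt0.
have [z zI zmax] := EVT_max (ltW t20) fc.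
have fz : 0 < f z.
  by apply: (lt_le_trans ft1); apply: zmax; rewrite in_itv/= !ltW.
have z0 : 0 < z.
  move: zI; rewrite in_itv/= => /andP[]; rewrite le_eqVlt => /predU1P[zE|//].
  by move: fz; rewrite -zE /f gpoly0 ?ltxx//; exact: gprim_exponent_gt0.
have z2 : z < t2.
  by rewrite ltNge; apply/negP => /fneg; rewrite ltNge ltW.
have fd (t : R) : 0 < t -> is_derive t 1 f (gpoly (terms G Omega s c a b w w) t
    / t).
  by move=> t0; exact: is_derive_gprim.
have zd : is_derive z 1 f 0.
  apply: (@derive1_at_max _ f 0 t2) => [|t||t]; first exact: ltW.
  - by rewrite in_itv/= => /andP[/fd[]].
  - by rewrite in_itv/= z0.
  - rewrite in_itv/= => /andP[tt0 tt2]; apply: zmax.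
    by rewrite in_itv/= !ltW.
have nz : gpoly (terms G Omega s c a b w w) z = 0.
  have [_ e1] := zd; have [_ e2] := fd _ z0.
  move: e2; rewrite e1 => /esym/eqP; rewrite mulf_eq0 invr_eq0 (gt_eqF z0) orbF.
  by move=> /eqP.
exists (fun y => z * w y), (fun y => z * w y).
rewrite (nehari_scale _ hG _ _ _ cs (lt0r_neq0 z0)).
rewrite (system_energy_scale _ hG _ _ _ cs (lt0r_neq0 z0)).
split => //; exact: CcZ.
Qed.

(** Subtracting [s^-1 * neh u v], which is 0, from the energy cancels the coupling and leaves the
    operator terms with the positive factors [ka] and [kb]. The concave terms are absorbed by half
    of these, whence the divisors [ka / 2] and [kb / 2]. *)
Lemma nehari_coercive e : exists B, forall u v, Cc Omega u -> Cc Omega v ->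
  neh u v = 0 -> energy u v <= e ->
  dirichlet G Omega (ord a) (expo a) u <= B /\
  dirichlet G Omega (ord b) (expo b) v <= B.
Proof.
have [_ [ca la ha]] := oka; have [_ [cb lb hb]] := okb.
have [[ga1 gaa gab as_] _] := oka; have [[gb1 gbb gba bs_] _] := okb.
pose ka := (expo a)^-1 - s^-1; pose kb := (expo b)^-1 - s^-1.
have ka0 : 0 < ka by rewrite subr_gt0 ltf_pV2 ?posrE.
have kb0 : 0 < kb by rewrite subr_gt0 ltf_pV2 ?posrE.
have ga0 : 0 < gam a by lra.
have gb0 : 0 < gam b by lra.
have la0 : 0 <= lam a * ((gam a)^-1 - s^-1).
  by rewrite mulr_ge0 ?ltW// subr_gt0 ltf_pV2 ?posrE//; lra.
have lb0 : 0 <= lam b * ((gam b)^-1 - s^-1).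
  by rewrite mulr_ge0 ?ltW// subr_gt0 ltf_pV2 ?posrE//; lra.
have ka2 : 0 < ka / 2 by lra.
have kb2 : 0 < kb / 2 by lra.
have [Ba Ba0 Bau] := power_integral_absorb Ofin emba ga0 gaa ha ka2 la0.
have [Bb Bb0 Bbv] := power_integral_absorb Ofin embb gb0 gbb hb kb2 lb0.
exists (Num.max ((e + Ba + Bb) / (ka / 2)) ((e + Ba + Bb) / (kb / 2))).
move=> u v uC vC n0 ee.
pose A := dirichlet G Omega (ord a) (expo a) u.
pose B := dirichlet G Omega (ord b) (expo b) v.
have A0 : 0 <= A by exact: dirichlet_ge0.
have B0 : 0 <= B by exact: dirichlet_ge0.
have : energy u v = ka * A + kb * B -
    lam a * ((gam a)^-1 - s^-1) * power_integral G Omega (pot a) (gam a) u -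
    lam b * ((gam b)^-1 - s^-1) * power_integral G Omega (pot b) (gam b) v.
  rewrite -[LHS]subr0 -(mulr0 s^-1) -n0 energyE nehE /ka /kb -/A -/B.
  ring.
have := Bau u uC; have := Bbv v vC; rewrite -/A -/B => H1 H2 E.
have P1 : 0 <= ka / 2 * A by apply: mulr_ge0 => //; exact: ltW.
have P2 : 0 <= kb / 2 * B by apply: mulr_ge0 => //; exact: ltW.
split; rewrite le_max !ler_pdivlMr// ![_ * (_ / 2)]mulrC; apply/orP.
  by left; lra.
by right; lra.
Qed.

Lemma continuous_coupling al be : 0 < al -> 0 < be ->
  continuous (fun w : T * T => coupling G Omega c al be w.1 w.2).
Proof.
move=> al0 be0; rewrite (_ : (fun w => _) = (fun w : T * T =>
    \sum_(x <- fset_set Omega)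
      c x * `|w.1 x| `^ al * `|w.2 x| `^ be * mu G x)); last first.
  by apply/funext => w; apply: integral_onE; exact: finite_Omega Ofin.
apply: continuous_bigsum => x _ w.
apply: (@continuousM _ (T * T)%type _ (cst _)); last exact: cst_continuous.
apply: (@continuousM _ (T * T)%type); [apply: (@continuousM _ (T * T)%type (cst
    _))|].
- exact: cst_continuous.
- apply: (@continuous_comp _ _ _ (fun w : T * T => w.1 x) (fun t : R => `|t| `^
    al)).
    apply: (@continuous_comp _ _ _ (fst : T * T -> T) (fun u : T => u x)).
      exact: cvg_fst.
    exact: proj_continuous.
  exact: continuous_norm_powR.
- apply: (@continuous_comp _ _ _ (fun w : T * T => w.2 x) (fun t : R => `|t| `^
    be)).
    apply: (@continuous_comp _ _ _ (snd : T * T -> T) (fun u : T => u x)).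
      exact: cvg_snd.
    exact: proj_continuous.
  exact: continuous_norm_powR.
Qed.

(** The free coefficients let the energy and the Nehari functional share one continuity proof. *)
Lemma continuous_on_pair (k1 k2 k3 k4 k5 : R) : continuous (fun w : T * T =>
  k1 * dirichlet G Omega (ord a) (expo a) w.1 +
  k2 * dirichlet G Omega (ord b) (expo b) w.2 -
  k3 * power_integral G Omega (pot a) (gam a) w.1 -
  k4 * power_integral G Omega (pot b) (gam b) w.2 -
  k5 * coupling G Omega c (cexp a) (cexp b) w.1 w.2).
Proof.
have [_ [ca la ha]] := oka; have [_ [cb lb hb]] := okb.
have [[ga1 gaa gab as_] _] := oka; have [[gb1 gbb gba bs_] _] := okb.
have c1 (f : T -> R) : continuous f -> continuous (fun w : T * T => f w.1).
  move=> fc w; apply: (@continuous_comp _ _ _ (fst : T * T -> T) f).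
    exact: cvg_fst.
  exact: fc.
have c2 (f : T -> R) : continuous f -> continuous (fun w : T * T => f w.2).
  move=> fc w; apply: (@continuous_comp _ _ _ (snd : T * T -> T) f).
    exact: cvg_snd.
  exact: fc.
have cM k (f : T * T -> R) : continuous f -> continuous (fun w => k * f w).
  move=> fc w; apply: (@continuousM _ (T * T)%type (cst k)) (fc w).
  exact: cst_continuous.
move=> w; apply: (@continuousB _ R (T * T)%type); last first.
  by apply: cM; exact: continuous_coupling.
apply: (@continuousB _ R (T * T)%type); last first.
  apply: cM; apply: (c2 (fun u => power_integral G Omega (pot b) (gam b) u)).
  by apply: continuous_power_integral => //; lra.
apply: (@continuousB _ R (T * T)%type); last first.
  apply: cM; apply: (c1 (fun u => power_integral G Omega (pot a) (gam a) u)).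
  by apply: continuous_power_integral => //; lra.
apply: (@continuousD _ R (T * T)%type).
  apply: cM; apply: (c1 (fun u => dirichlet G Omega (ord a) (expo a) u)).
  exact: continuous_dirichlet.
apply: cM; apply: (c2 (fun u => dirichlet G Omega (ord b) (expo b) u)).
exact: continuous_dirichlet.
Qed.

Lemma exists_nehari_minimizer : exists u v, nehari_minimizer G Omega s c a b u
    v.
Proof.
have [u0 [v0 [u0C v0C n00 e00]]] := nehari_nonempty.
have [B Buv] := nehari_coercive (energy u0 v0).
have ec : continuous (fun w : T * T => energy w.1 w.2).
  rewrite (_ : (fun w => _) = (fun w : T * T =>
      (expo a)^-1 * dirichlet G Omega (ord a) (expo a) w.1 +
      (expo b)^-1 * dirichlet G Omega (ord b) (expo b) w.2 -
      lam a / gam a * power_integral G Omega (pot a) (gam a) w.1 -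
      lam b / gam b * power_integral G Omega (pot b) (gam b) w.2 -
      s^-1 * coupling G Omega c (cexp a) (cexp b) w.1 w.2)).
    exact: continuous_on_pair.
  by apply/funext => w; rewrite energyE; ring.
have nc : continuous (fun w : T * T => neh w.1 w.2).
  rewrite (_ : (fun w => _) = (fun w : T * T =>
      1 * dirichlet G Omega (ord a) (expo a) w.1 +
      1 * dirichlet G Omega (ord b) (expo b) w.2 -
      lam a * power_integral G Omega (pot a) (gam a) w.1 -
      lam b * power_integral G Omega (pot b) (gam b) w.2 -
      1 * coupling G Omega c (cexp a) (cexp b) w.1 w.2)).
    exact: continuous_on_pair.
  by apply/funext => w; rewrite nehE; ring.
pose Sa := [set u : T | Cc Omega u /\ dirichlet G Omega (ord a) (expo a) u <=
    B].
pose Sb := [set v : T | Cc Omega v /\ dirichlet G Omega (ord b) (expo b) v <=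
    B].
(* The open condition of positive energy is replaced by [rho <= energy], which by [nehari_energy_ge]
   selects the same Nehari points and is closed. *)
pose S := ((Sa `*` Sb) `&` [set w : T * T | neh w.1 w.2 = 0]) `&`
  [set w : T * T | rho <= energy w.1 w.2].
have Sc : compact S.
  apply: compact_closedI.
    apply: compact_closedI.
      by apply: compact_setX; exact: compact_dirichlet_sublevel.
    apply: (@closed_comp _ _ (fun w : T * T => neh w.1 w.2) [set y | y = 0]).
      by move=> w _; exact: nc.
    exact: closed_eq.
  apply: (@closed_comp _ _ (fun w : T * T => energy w.1 w.2) [set y | rho <=
      y]).
    by move=> w _; exact: ec.
  exact: closed_ge.
have S0 : S (u0, v0).
  have [Au Bv] := Buv _ _ u0C v0C n00 (lexx _).
  by do 3?split => //; exact: nehari_energy_ge.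
have Sn0 : S !=set0 by exists (u0, v0).
have [[u v] /set_mem[[[[/= uC Au] [/= vC Bv]] n0] /= eu] umin] :=
  compact_EVT_min Sn0 Sc (continuous_subspaceT ec).
exists u, v; split => //; first exact: lt_le_trans eu.
move=> u' v' u'C v'C n' e'.
(* A competitor with more energy than the reference pair may lie outside the compact set, but the
   reference pair already bounds the minimum from above. *)
have [le0|lt0] := leP (energy u' v') (energy u0 v0).
  have [Au' Bv'] := Buv _ _ u'C v'C n' le0.
  apply: (umin (u', v')); apply: mem_set.
  by do 3?split => //; exact: nehari_energy_ge.
apply: le_trans (ltW lt0); apply: (umin (u0, v0)); exact: mem_set.
Qed.

End NehariMinimizer.

(** * The lower bound on a sphere *)

Section Inequalities.
Context {R : realType}.
Implicit Types X Y p P : R.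

(** Convexity of the power at the midpoint; the factor [2 ^ (1 - max p q)] of [M] originates
    here. *)
Lemma powR_half_sum_le P X Y : 1 <= P -> 0 <= X -> 0 <= Y ->
  2 `^ (1 - P) * (X + Y) `^ P <= X `^ P + Y `^ P.
Proof.
move=> P1 X0 Y0.
have : (2^-1 * X + (1 - 2^-1) * Y) `^ P <=
    2^-1 * X `^ P + (1 - 2^-1) * Y `^ P.
  have h0 : (0 : R) <= 2^-1 by rewrite invr_ge0.
  have h1 : (2 : R)^-1 <= 1 by rewrite invf_le1// ler1n.
  by apply: (convex_powR P1 (Itv01 h0 h1));
    apply: mem_set; rewrite /= in_itv/= andbT.
rewrite (_ : 1 - 2^-1 = 2^-1); last by field.
rewrite -!mulrDr powRM ?addr_ge0// -powR_inv1// -powRrM mulN1r.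
have two0 : (0 : R) < 2 by [].
move=> H; rewrite -(ler_pM2l (powR_gt0 (-1) two0)) mulrA -powRD.
  by rewrite addrA addNr add0r.
by rewrite (gt_eqF two0) implybT.
Qed.

Lemma powR_le_small p P X : 0 <= X -> X <= 1 -> 0 < p -> p <= P ->
  X `^ P <= X `^ p.
Proof.
move=> X0 X1 p0 pP; have [->|Xn0] := eqVneq X 0.
  by rewrite !powR0 ?gt_eqF// (lt_le_trans p0).
by apply: ger_powR => //; rewrite X1 andbT lt_neqAle eq_sym Xn0.
Qed.

(* The maximum over [t >= 0] of [M t ^ P - N t ^ s]. *)
Lemma powR_diff_max (M N P s : R) : 0 < M -> 0 < N -> 0 < P -> P < s ->
  let t := (P * M / (s * N)) `^ (s - P)^-1 in
  M * t `^ P - N * t `^ s =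
  (s - P) / s * M `^ (s / (s - P)) * (P / (s * N)) `^ (P / (s - P)).
Proof.
move=> M0 N0 P0 Ps; have s0 := lt_trans P0 Ps.
have sP : 0 < s - P by rewrite subr_gt0.
have sN : 0 < s * N by exact: mulr_gt0.
have th0 : 0 < P * M / (s * N) by rewrite divr_gt0// mulr_gt0.
cbv zeta; rewrite -!powRrM !(mulrC (s - P)^-1).
have -> : s / (s - P) = 1 + P / (s - P) by field; rewrite gt_eqF.
rewrite !(@powRD _ _ 1) ?(gt_eqF th0) ?(gt_eqF M0) ?implybT// !powRr1 ?ltW//.
rewrite (_ : P * M / (s * N) = M * (P / (s * N))); last by ring.
rewrite powRM ?ltW// ?divr_gt0//; field.
by rewrite !gt_eqF.
Qed.

(** The origin of the factor [1 - l * B]: Young's inequality turns the concave integral [H] into a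
    share of [I], the [p]-th power of the Lebesgue norm, which the embedding pays from the operator
    term [N]. The rest depends only on the potential. *)
Lemma young_absorb (l g p B N I H h : R) : 0 < l -> 0 < g -> 0 < p ->
  H <= (p - g) / p * h + g / p * I -> I <= B * N ->
  (1 - l * B) / p * N - l * (p - g) / (p * g) * h <= N / p - l / g * H.
Proof.
move=> l0 g0 p0 HI IN.
have lg : 0 < l / g by exact: divr_gt0.
have lp : 0 < l / p by exact: divr_gt0.
have := ler_wpM2l (ltW lg) HI; have := ler_wpM2l (ltW lp) IN.
have -> : l / g * ((p - g) / p * h + g / p * I) =
    l * (p - g) / (p * g) * h + l / p * I by field; rewrite !gt_eqF.
have -> : (1 - l * B) / p * N = N / p - l / p * (B * N).
  by field; rewrite gt_eqF.
lra.
Qed.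

(** Since [r <= 1], both [X] and [Y] are at most 1, so replacing [p] and [q] by their maximum only
    decreases the powers; with a common exponent they combine by convexity. *)
Lemma ridge_energy (p q ka kb X Y r Sa Sb A B HA HB K L : R) :
  1 < p -> 1 < q -> 0 < Num.min ka kb -> 0 <= X -> 0 <= Y -> X + Y = r ->
  r <= 1 -> ka * X `^ p - Sa <= A - HA -> kb * Y `^ q - Sb <= B - HB -> K <= L
      ->
  2 `^ (1 - Num.max p q) * Num.min ka kb * r `^ Num.max p q - L - (Sa + Sb) <=
  A + B - HA - HB - K.
Proof.
move=> p1 q1; set kap := Num.min ka kb => kap0 X0 Y0 Nr r1 Ea Eb KL.
set P := Num.max p q; have p0 := lt_trans ltr01 p1; have q0 := lt_trans ltr01
    q1.
have [pP qP] : p <= P /\ q <= P by rewrite !le_max !lexx orbT.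
have [ka_ge kb_ge] : kap <= ka /\ kap <= kb by rewrite !ge_min !lexx orbT.
have P1 : 1 <= P by exact: le_trans (ltW p1) pP.
clearbody P kap.
have X1 : X <= 1 by lra.
have Y1 : Y <= 1 by lra.
have HX : kap * X `^ P <= ka * X `^ p.
  by apply: ler_pM; rewrite ?powR_ge0 ?(ltW kap0)//; exact: powR_le_small.
have HY : kap * Y `^ P <= kb * Y `^ q.
  by apply: ler_pM; rewrite ?powR_ge0 ?(ltW kap0)//; exact: powR_le_small.
have : 2 `^ (1 - P) * kap * r `^ P <= kap * X `^ P + kap * Y `^ P.
  rewrite -mulrDr mulrAC mulrC; apply: ler_wpM2l; first exact: ltW.
  by rewrite -Nr; exact: powR_half_sum_le.
lra.
Qed.

(** Bounding [X] and [Y] each by [r] gives the constant [M2]. One factor of [s ^ 2] is the weight of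
    the coupling in the energy, the other comes from Young's inequality. *)
Lemma ridge_coupling (s al be C0 D1 D2 X Y r I J K : R) : 0 < s -> 0 <= C0 ->
  0 <= al -> 0 <= be -> 0 <= D1 -> 0 <= D2 -> 0 <= X -> 0 <= Y -> X + Y = r ->
  I <= D1 * X `^ s -> J <= D2 * Y `^ s -> K <= C0 / s * (al * I + be * J) ->
  s^-1 * K <= C0 / s ^+ 2 * (al * D1 + be * D2) * r `^ s.
Proof.
move=> s0 C00 al0 be0 D10 D20 X0 Y0 Nr HI HJ HK.
have mono Z D N : 0 <= D -> 0 <= Z -> Z <= r -> N <= D * Z `^ s ->
    N <= D * r `^ s.
  move=> D0 Z0 Zr /le_trans; apply; apply: ler_wpM2l => //.
  apply: ge0_ler_powR; rewrite ?nnegrE ?(ltW s0)//; exact: le_trans Zr.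
have {}HI : I <= D1 * r `^ s by apply: mono HI => //; lra.
have {}HJ : J <= D2 * r `^ s by apply: mono HJ => //; lra.
have sC : 0 <= C0 / s by rewrite divr_ge0// ltW.
have := ler_wpM2l sC (lerD (ler_wpM2l al0 HI) (ler_wpM2l be0 HJ)).
move=> IJ; rewrite [leLHS]mulrC ler_pdivrMr//.
apply: le_trans HK (le_trans IJ _).
rewrite le_eqVlt; apply/orP; left; apply/eqP.
by field; rewrite gt_eqF.
Qed.

End Inequalities.

(** * Young's inequality and the embedding constants *)

Section EmbeddingBounds.
Context {R : realType} {V : choiceType}.
Variables (G : wgraph R V) (Omega : set V).
Hypothesis hG : locally_finite G.
Hypothesis Ofin : finite_set (clos G Omega).
Implicit Types (a b : side R V) (u v : V -> R) (x : V).

Lemma le_sup_finite (A : set V) u x : finite_set A -> A x ->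
  u x <= sup [set u y | y in A].
Proof.
move=> Afin Ax; apply: ub_le_sup; last by exists x.
exists (\sum_(z <- fset_set A) `|u z|) => _ [y Ay <-].
rewrite (bigD1_seq y)/= ?fset_uniq//; last first.
  by rewrite in_fset_set//; exact: mem_set.
by rewrite (le_trans (ler_norm _))// lerDl sumr_ge0.
Qed.

Lemma embedding_sup a C : embedding_constant G Omega (ord a) (expo a) C ->
  expo a != 0 -> sup_embedding G Omega a.
Proof.
move=> [C0 Cu] p0; exists C; first exact: ltW.
move=> u uC x; have [Ox|nOx] := pselect (Omega x); last first.
  by rewrite uC// normr0 mulr_ge0 ?powR_ge0// ltW.
have Wu : W0 G Omega (ord a) (expo a) u by rewrite W0E.
apply: le_trans (Cu _ Wu +oo%E _); last by rewrite leey.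
by apply: (@le_sup_finite _ (fun x => `|u x|)) => //; exact: finite_Omega Ofin.
Qed.

Lemma embedding_power m p C r u : embedding_constant G Omega m p C ->
  p != 0 -> 1 <= r -> Cc Omega u ->
  integral_on G Omega (fun x => `|u x| `^ r) <=
  C `^ r * W0norm G Omega m p u `^ r.
Proof.
move=> [C0 Cu] p0 r1 uC; have r0 : 0 < r by rewrite (lt_le_trans ltr01).
have Wu : W0 G Omega m p u by rewrite W0E.
have := Cu _ Wu r%:E; rewrite lee_fin => /(_ r1) /= le_u.
have I0 : 0 <= integral_on G Omega (fun x => `|u x| `^ r).
  by apply: integral_on_ge0 => x _; exact: powR_ge0.
rewrite -powRM ?powR_ge0 ?(ltW C0)// -[leLHS]powRr1//.
rewrite -(mulVf (lt0r_neq0 r0)) powRrM; apply: ge0_ler_powR => //.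
- exact: ltW.
- by rewrite nnegrE powR_ge0.
- by rewrite nnegrE mulr_ge0 ?powR_ge0// ltW.
Qed.

(** Young's inequality at each vertex with the conjugate exponents [p / (p - g)] and [p / g]; the
    first is the Lebesgue exponent of the potential in condition (4). *)
Lemma young_power_integral (p g : R) h u : 0 < g -> g < p ->
  (forall x, Omega x -> 0 < h x) ->
  power_integral G Omega h g u <=
  (p - g) / p * normL G Omega (p / (p - g))%:E h `^ (p / (p - g)) +
  g / p * integral_on G Omega (fun x => `|u x| `^ p).
Proof.
move=> g0 gp h0; have p0 := lt_trans g0 gp.
have pg : 0 < p - g by rewrite subr_gt0.
rewrite /= -powRrM mulVf ?powRr1; last 2 first.
- by apply: integral_on_ge0 => x _; exact: powR_ge0.
- by rewrite gt_eqF// divr_gt0.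
rewrite -!integral_onZ -integral_onD; last exact: finite_Omega Ofin.
apply: le_integral_on => [|x Ox]; first exact: finite_Omega Ofin.
have := @conjugate_powR _ (h x) (`|u x| `^ g) (p / (p - g)) (p / g)
  (ltW (h0 _ Ox)) (powR_ge0 _ _) (divr_gt0 p0 pg) (divr_gt0 p0 g0).
rewrite !invf_div -powRrM (mulrCA g) divff ?gt_eqF// mulr1.
rewrite -mulrDl subrK divff ?gt_eqF// => /(_ erefl) Y; apply: le_trans Y _.
by rewrite (gtr0_norm (h0 _ Ox)) le_eqVlt; apply/orP; left; apply/eqP; ring.
Qed.

(** Young's inequality at each vertex with the conjugate exponents [(al + be) / al] and
    [(al + be) / be], which raises both factors to the power [al + be]. *)
Lemma young_coupling (c : V -> R) (C0 al be : R) u v : 0 < al -> 0 < be ->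
  (forall x, Omega x -> 0 < c x <= C0) ->
  coupling G Omega c al be u v <= C0 / (al + be) *
  (al * integral_on G Omega (fun x => `|u x| `^ (al + be)) +
   be * integral_on G Omega (fun x => `|v x| `^ (al + be))).
Proof.
move=> al0 be0 cC; have s0 : 0 < al + be by exact: addr_gt0.
rewrite -!integral_onZ -integral_onD -?integral_onZ; last exact: finite_Omega
    Ofin.
apply: le_integral_on => [|x Ox]; first exact: finite_Omega Ofin.
have /andP[cx0 cxC] := cC _ Ox.
have := @conjugate_powR _ (`|u x| `^ al) (`|v x| `^ be) ((al + be) / al)
  ((al + be) / be) (powR_ge0 _ _) (powR_ge0 _ _) (divr_gt0 s0 al0)
  (divr_gt0 s0 be0).
rewrite !invf_div -!powRrM (mulrCA al) (mulrCA be) !divff ?gt_eqF// !mulr1.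
rewrite -mulrDl divff ?gt_eqF// => /(_ erefl) Y.
rewrite -mulrA; apply: (@le_trans _ _ (C0 * (`|u x| `^ al * `|v x| `^ be))).
  by apply: ler_wpM2r => //; rewrite mulr_ge0 ?powR_ge0.
rewrite -mulrA; apply: ler_wpM2l; first by rewrite (le_trans (ltW cx0)).
apply: le_trans Y _; rewrite le_eqVlt; apply/orP; left; apply/eqP.
by field; rewrite gt_eqF.
Qed.

Lemma side_energy_ge a C u : embedding_constant G Omega (ord a) (expo a) C ->
  0 < gam a -> gam a < expo a -> 1 < expo a -> 0 < lam a ->
  (forall x, Omega x -> 0 < pot a x) -> Cc Omega u ->
  (1 - lam a * C `^ expo a) / expo a *
    W0norm G Omega (ord a) (expo a) u `^ expo a -
  lam a * (expo a - gam a) / (expo a * gam a) *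
    normL G Omega (expo a / (expo a - gam a))%:E (pot a) `^
      (expo a / (expo a - gam a)) <=
  dirichlet G Omega (ord a) (expo a) u / expo a -
  lam a / gam a * power_integral G Omega (pot a) (gam a) u.
Proof.
move=> emb g0 gp p1 l0 h0 uC; have p0 := lt_trans ltr01 p1.
have HI := young_power_integral u g0 gp h0.
have IN := embedding_power emb (lt0r_neq0 p0) (ltW p1) uC.
rewrite dirichletE ?gt_eqF//; move: HI IN; exact: young_absorb.
Qed.

End EmbeddingBounds.

(** * The energy on a sphere of radius at most 1 *)

Section Ridge.
Context {R : realType} {V : choiceType}.
Variables (G : wgraph R V) (Omega : set V).
Hypothesis hG : locally_finite G.
Hypothesis Ofin : finite_set (clos G Omega).
Variables (s : R) (c : V -> R) (a b : side R V) (C0 C1 C2 : R).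
Hypothesis c_bound : forall x, Omega x -> 0 < c x <= C0.
Hypotheses (cs : cexp a + cexp b = s).
Hypotheses (oka : side_ok Omega s a b) (okb : side_ok Omega s b a).
Hypothesis emba : embedding_constant G Omega (ord a) (expo a) C1.
Hypothesis embb : embedding_constant G Omega (ord b) (expo b) C2.
Implicit Types (u v : V -> R) (x : V).

Let P := Num.max (expo a) (expo b).
Let kap := Num.min ((1 - lam a * C1 `^ expo a) / expo a)
  ((1 - lam b * C2 `^ expo b) / expo b).
Let M := 2 `^ (1 - P) * kap.
Let M2 := C0 / s ^+ 2 * (cexp a * C1 `^ s + cexp b * C2 `^ s).
Let Sa := lam a * (expo a - gam a) / (expo a * gam a) *
  normL G Omega (expo a / (expo a - gam a))%:E (pot a) `^
    (expo a / (expo a - gam a)).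
Let Sb := lam b * (expo b - gam b) / (expo b * gam b) *
  normL G Omega (expo b / (expo b - gam b))%:E (pot b) `^
    (expo b / (expo b - gam b)).

Lemma system_energy_ridge r u v : 0 < kap -> 0 < C0 -> r <= 1 ->
  Cc Omega u -> Cc Omega v ->
  W0norm G Omega (ord a) (expo a) u + W0norm G Omega (ord b) (expo b) v = r ->
  M * r `^ P - M2 * r `^ s - (Sa + Sb) <= system_energy G Omega s c a b u v.
Proof.
move=> kap0 C00 r1 uC vC Nr.
have [[ga1 gaa gab as_] [ca la ha]] := oka.
have [[gb1 gbb gba bs_] [cb lb hb]] := okb.
have ga0 := lt_trans ltr01 ga1; have gb0 := lt_trans ltr01 gb1.
have a1 := lt_trans ga1 gaa; have b1 := lt_trans gb1 gbb.
have a0 := lt_trans ltr01 a1; have b0 := lt_trans ltr01 b1.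
have s0 := lt_trans a0 as_; have s1 := lt_trans a1 as_.
have Ea := side_energy_ge Ofin emba ga0 gaa a1 la ha uC.
have Eb := side_energy_ge Ofin embb gb0 gbb b1 lb hb vC.
have Ua := embedding_power emba (lt0r_neq0 a0) (ltW s1) uC.
have Vb := embedding_power embb (lt0r_neq0 b0) (ltW s1) vC.
have X0 := powR_ge0 (dirichlet G Omega (ord a) (expo a) u) (expo a)^-1.
have Y0 := powR_ge0 (dirichlet G Omega (ord b) (expo b) v) (expo b)^-1.
have HK := young_coupling Ofin u v ca cb c_bound; rewrite cs in HK.
rewrite energyE; apply: (ridge_energy a1 b1 kap0 X0 Y0 Nr r1 Ea Eb).
apply: (ridge_coupling s0 (ltW C00) (ltW ca) (ltW cb) _ _ X0 Y0 Nr Ua Vb HK).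
- exact: powR_ge0.
- exact: powR_ge0.
Qed.

End Ridge.

(** * From the equations at vertices to solutions of the system *)

Section SolutionPairs.
Context {R : realType} {V : choiceType}.
Variables (G : wgraph R V) (Omega : set V).
Hypothesis hG : locally_finite G.
Hypothesis Ofin : finite_set (clos G Omega).
Variables (m1 m2 : nat) (p q g1 g2 al be l1 l2 : R) (h1 h2 c : V -> R).
Hypotheses (p0 : 0 < p) (q0 : 0 < q) (g10 : 0 < g1) (g20 : 0 < g2).
Hypotheses (al0 : 0 < al) (be0 : 0 < be).
Implicit Types (u v : V -> R) (x : V).

Let a := Side m1 p g1 l1 h1 al.
Let b := Side m2 q g2 l2 h2 be.

Lemma energy_system u v :
  energy G Omega m1 m2 p q g1 g2 al be l1 l2 h1 h2 c u v =
  system_energy G Omega (al + be) c a b u v.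
Proof.
by rewrite energyE /energy /dirichlet /power_integral /coupling /=; ring.
Qed.

Lemma energy_semitrivial u :
  energy G Omega m1 m2 p q g1 g2 al be l1 l2 h1 h2 c u (fun=> 0) =
  scalar_energy G Omega a u.
Proof.
have K0 : coupling G Omega c al be u (fun=> 0) = 0.
  rewrite /coupling /integral_on fsbig1// => x _.
  by rewrite normr0 (powR0 (lt0r_neq0 be0)) mulr0 mul0r.
rewrite energy_system energyE K0 /scalar_energy dirichlet0 ?gt_eqF//.
by rewrite power_integral0 ?gt_eqF// mul0r !mulr0 !subr0 addr0.
Qed.

Lemma energy_trivial :
  energy G Omega m1 m2 p q g1 g2 al be l1 l2 h1 h2 c (fun=> 0) (fun=> 0) = 0.
Proof.
rewrite energy_semitrivial /scalar_energy dirichlet0 ?gt_eqF//.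
by rewrite power_integral0 ?gt_eqF// mul0r mulr0 subr0.
Qed.

Lemma solution_pointwise u v : Cc Omega u -> Cc Omega v ->
  (forall x, Omega x -> pounds_form G Omega m1 p u (bump x) =
    (l1 * h1 x * (`|u x| `^ (g1 - 2) * u x) +
     al / (al + be) * c x * (`|u x| `^ (al - 2) * u x) * `|v x| `^ be) *
    mu G x) ->
  (forall x, Omega x -> pounds_form G Omega m2 q v (bump x) =
    (l2 * h2 x * (`|v x| `^ (g2 - 2) * v x) +
     be / (al + be) * c x * `|u x| `^ al * (`|v x| `^ (be - 2) * v x)) *
    mu G x) ->
  solution G Omega m1 m2 p q g1 g2 al be l1 l2 h1 h2 c u v.
Proof.
move=> uC vC Eu Ev; split.
- by rewrite W0E ?gt_eqF.
- by rewrite W0E ?gt_eqF.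
- exists (fun x => l1 * h1 x * (`|u x| `^ (g1 - 2) * u x) +
    al / (al + be) * c x * (`|u x| `^ (al - 2) * u x) * `|v x| `^ be) => //.
  exact: is_pounds_bump.
- exists (fun x => l2 * h2 x * (`|v x| `^ (g2 - 2) * v x) +
    be / (al + be) * c x * `|u x| `^ al * (`|v x| `^ (be - 2) * v x)) => //.
  exact: is_pounds_bump.
- by move=> x [nOx _]; rewrite uC ?vC.
Qed.

End SolutionPairs.

Theorem theorem1p1 (R : realType) (V : choiceType) (G : wgraph R V)
    (hG : locally_finite G) (Omega : set V)
    (hbd : bounded_domain G (clos G Omega))
    (hOmega : Omega !=set0) (hbdry : bdry G Omega !=set0)
    (C : nat -> R -> R)
    (hC : forall (m : nat) (s : R), (0 < m)%N -> 1 < s ->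
            embedding_constant G Omega m s (C m s))
    (m1 m2 : nat) (hm1 : (0 < m1)%N) (hm2 : (0 < m2)%N)
    (p q g1 g2 al be : R)
    (hp : 1 < p) (hq : 1 < q) (hg1 : 1 < g1) (hg2 : 1 < g2)
    (hal : 0 < al) (hbe : 0 < be)
    (hgpq : Num.max g1 g2 < Num.min p q)
    (hpqab : Num.max p q < al + be)
    (h1 h2 c : V -> R)
    (hh1 : forall x, Omega x -> 0 < h1 x)
    (hh2 : forall x, Omega x -> 0 < h2 x)
    (hc : forall x, Omega x -> 0 < c x)
    (l1 l2 : R) :
  let C1 := C m1 p in
  let C2 := C m2 q in
  let pq := Num.max p q in
  let C0 := sup [set c x | x in Omega] in
  let M := 2 `^ (1 - pq) *
    Num.min ((1 - l1 * C1 `^ p) / p) ((1 - l2 * C2 `^ q) / q) in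
  let M2 := C0 / (al + be) ^+ 2 *
    (al * C1 `^ (al + be) + be * C2 `^ (al + be)) in
  0 < l1 < C1 `^ (- p) ->
  0 < l2 < C2 `^ (- q) ->
  M <= (al + be) / pq * M2 ->
  l1 * (p - g1) / (p * g1) *
      normL G Omega (p / (p - g1))%:E h1 `^ (p / (p - g1)) +
    l2 * (q - g2) / (q * g2) *
      normL G Omega (q / (q - g2))%:E h2 `^ (q / (q - g2))
    < (al + be - pq) / (al + be) * M `^ ((al + be) / (al + be - pq)) *
      (pq / ((al + be) * M2)) `^ (pq / (al + be - pq)) ->
  (exists u v : V -> R,
    [/\ solution G Omega m1 m2 p q g1 g2 al be l1 l2 h1 h2 c u v,
        (u, v) <> (fun=> 0, fun=> 0)
      & 0 < energy G Omega m1 m2 p q g1 g2 al be l1 l2 h1 h2 c u v]) /\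
  (exists u v : V -> R,
    [/\ solution G Omega m1 m2 p q g1 g2 al be l1 l2 h1 h2 c u v,
        (u, v) <> (fun=> 0, fun=> 0)
      & energy G Omega m1 m2 p q g1 g2 al be l1 l2 h1 h2 c u v < 0]).
Proof.
move=> C1 C2 P C0 M M2 l1C l2C HM HS.
have Ofin : finite_set (clos G Omega) by exact: finite_bounded_domain.
have p0 := lt_trans ltr01 hp; have q0 := lt_trans ltr01 hq.
have g10 := lt_trans ltr01 hg1; have g20 := lt_trans ltr01 hg2.
have s0 : 0 < al + be by exact: addr_gt0.
move: (hgpq); rewrite lt_min !gt_max => /andP[/andP[g1p g2p] /andP[g1q g2q]].
move: (hpqab); rewrite gt_max => /andP[ps qs].
have /andP[l10 l1lt] := l1C; have /andP[l20 l2lt] := l2C.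
have emb1 : embedding_constant G Omega m1 p C1 by exact: hC.
have emb2 : embedding_constant G Omega m2 q C2 by exact: hC.
have C1_gt0 : 0 < C1 := emb1.1.
have C2_gt0 : 0 < C2 := emb2.1.
pose a := Side m1 p g1 l1 h1 al; pose b := Side m2 q g2 l2 h2 be.
have oka : side_ok Omega (al + be) a b by split; split.
have okb : side_ok Omega (be + al) b a by rewrite addrC; split; split.
rewrite addrC in okb.
have sup1 : sup_embedding G Omega a.
  exact: (@embedding_sup _ _ G Omega Ofin a C1 emb1 (lt0r_neq0 p0)).
have sup2 : sup_embedding G Omega b.
  exact: (@embedding_sup _ _ G Omega Ofin b C2 emb2 (lt0r_neq0 q0)).
have triv u v :
    energy G Omega m1 m2 p q g1 g2 al be l1 l2 h1 h2 c u v <> 0 ->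
    (u, v) <> (fun=> 0, fun=> 0).
  by move=> e0 [uE vE]; apply: e0; rewrite uE vE energy_trivial.
split; last first.
  have [u [uC eu umin]] := scalar_minimizer hG Ofin hOmega sup1 hg1 g1p l10 hh1.
  exists u, (fun=> 0); rewrite energy_semitrivial//; split => //.
    (* With [v = 0] the coupling drops out of the first equation because [be > 0], and every term of
       the second is 0. *)
    apply: solution_pointwise => // x Ox.
      rewrite normr0 (powR0 (lt0r_neq0 hbe)) mulr0 addr0.
      exact: (scalar_minimizer_equation hG Ofin (a := a) hg1 hp uC umin Ox).
    by rewrite pounds_form0l// !mulr0 addr0 mul0r.
  by apply: triv; rewrite energy_semitrivial//; apply/eqP; rewrite lt_eqF.
have Ofin' : finite_set Omega := finite_Omega Ofin.
have c_bound x : Omega x -> 0 < c x <= C0.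
  by move=> Ox; rewrite hc//; exact: le_sup_finite.
have C0_gt0 : 0 < C0.
  by have [x /c_bound/andP[cx]] := hOmega; exact: lt_le_trans.
have k1 : 0 < 1 - l1 * C1 `^ p.
  by rewrite subr_gt0 -ltr_pdivlMr ?powR_gt0// mul1r -powRN.
have k2 : 0 < 1 - l2 * C2 `^ q.
  by rewrite subr_gt0 -ltr_pdivlMr ?powR_gt0// mul1r -powRN.
have kap0 : 0 < Num.min ((1 - l1 * C1 `^ p) / p) ((1 - l2 * C2 `^ q) / q).
  by rewrite lt_min !divr_gt0.
have M_gt0 : 0 < M by rewrite mulr_gt0// powR_gt0.
have M2_gt0 : 0 < M2.
  by rewrite mulr_gt0 ?divr_gt0 ?exprn_gt0// addr_gt0// mulr_gt0 ?powR_gt0.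
have P0 : 0 < P by rewrite lt_max p0.
(* Setting the derivative of [M * r ^ P - M2 * r ^ (al + be)] to 0 gives [r ^ (al + be - P) = th];
   condition (3) is the statement [th <= 1]. *)
pose th := P * M / ((al + be) * M2).
have sM2 : 0 < (al + be) * M2 by exact: mulr_gt0.
have th0 : 0 < th by rewrite divr_gt0// mulr_gt0.
have th1 : th <= 1.
  rewrite ler_pdivrMr// mul1r mulrC -ler_pdivlMr//.
  by move: HM; rewrite mulrAC.
pose r := th `^ (al + be - P)^-1.
have sP : 0 < al + be - P by rewrite subr_gt0.
have r0 : 0 < r by rewrite powR_gt0.
have r1 : r <= 1.
  apply: (@le_trans _ _ (1 `^ (al + be - P)^-1)); last by rewrite powR1.
  apply: ge0_ler_powR.
  - by rewrite invr_ge0 ltW.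
  - by rewrite nnegrE ltW.
  - by rewrite nnegrE.
  - exact: th1.
have rmax := powR_diff_max M_gt0 M2_gt0 P0 hpqab; rewrite -/th -/r in rmax.
(* The right side of condition (4) is the value of [M * r ^ P - M2 * r ^ (al + be)] at this [r]; its
   excess over the left side is the height [rho]. *)
move: HS; rewrite -rmax -subr_gt0 => rho0.
have [|u [v uvmin]] := exists_nehari_minimizer hG Ofin hOmega hc erefl oka okb
    sup1 sup2 r0 rho0.
  move=> u v uC vC Nr.
  exact: (system_energy_ridge Ofin c_bound erefl oka okb emb1 emb2 kap0 C0_gt0
    r1 uC vC Nr).
have [[uC vC] _ e0 _] := uvmin.
exists u, v; rewrite energy_system; split => //; last first.
  by apply: triv; rewrite energy_system; apply/eqP; rewrite gt_eqF.
apply: solution_pointwise => // x Ox.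
  exact: (nehari_minimizer_equation hG Ofin hc erefl oka okb uvmin Ox).
(* The second equation is the first one for the exchanged sides, the minimizer property being
   symmetric. *)
rewrite (nehari_minimizer_equation (a := b) (b := a) hG Ofin hc (addrC be al)
  okb oka (nehari_minimizerC uvmin) Ox) /=.
by ring.
Qed.
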